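(* Let $(\lambda_n)_{n\geq 1}$ be a sequence of points in the open unit disk $\mathbb{D}$, and let $B_0=1$ and $B_n(z)=\prod_{k=1}^n \frac{\lambda_k-z}{1-\overline{\lambda}_k z}$ for $n\ge 1$. Then the following assertions are equivalent. (i) The sequence $(B_n)_{n\geq 0}$ is a Schauder basis for $\mathrm{Hol}(\overline{\mathbb{D}})$ equipped with its natural topology. (ii) $\sup_{n\geq 1}|\lambda_n|<1$.
   Context: $\mathrm{Hol}(\overline{\mathbb{D}})$ is the space of functions analytic in a neighborhood of the closed unit disk $\overline{\mathbb{D}}$. For an open disk $D$, $\mathcal{A}(D)=\mathrm{Hol}(D)\cap C(\overline{D})$ with the sup norm on $D$. The natural topology of $\mathrm{Hol}(\overline{\mathbb{D}})$ is the inductive limit topology of the family of Banach spaces $\{\mathcal{A}(r_n\mathbb{D})\}_{n\ge 1}$ with $r_n=1+\frac1n$. Concretely, a sequence $(f_n)_{n\ge 0}$ converges to $f$ in $\mathrm{Hol}(\overline{\mathbb{D}})$ if and only if there exists $R_0>1$ such that $f_n,f\in\mathcal{A}(R_0\mathbb{D})$ for all sufficiently large $n$ and $f_n\to f$ uniformly on $R_0\mathbb{D}$. A sequence $(x_n)_{n\ge 0}$ in a complex topological linear space $\mathcal{X}$ is a Schauder basis for $\mathcal{X}$ if for each $x\in\mathcal{X}$ there is a unique sequence $(a_n)_{n\ge 0}$ of complex numbers such that $x=\sum_{n=0}^\infty a_nx_n$, with convergence in the topology of $\mathcal{X}$. *)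

(* Defs.v *)
From HB Require Import structures.
From mathcomp Require Import all_boot all_order all_algebra.
From mathcomp Require Import complex ring lra.
From mathcomp Require Import all_classical all_reals all_analysis.
Set Implicit Arguments.
Unset Strict Implicit.
Unset Printing Implicit Defensive.
Import Order.TTheory GRing.Theory Num.Theory.
Import numFieldNormedType.Exports.
Local Open Scope classical_set_scope.
Local Open Scope ring_scope.

(* MathComp-Analysis puts the norm topology on abstract numFieldTypes only;
   R[i] gets it from its regular module. *)
HB.instance Definition _ (R : realType) := NormedModule.copy R[i] (R[i]^o).

(* The modulus as a real number: `|z| : R[i] is its image in R[i]. *)
Notation normc := (@ComplexField.Normc.normc _).

Arguments ComplexField.Normc.normc : simpl never.

Definition disk (R : realType) (r : R) : set R[i] := [set z | normc z < r].
Definition cdisk (R : realType) (r : R) : set R[i] := [set z | normc z <= r].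

Definition analytic_at (R : realType) (g : R[i] -> R[i]) (z0 : R[i]) :=
  exists a : nat -> R[i],
    \forall z \near z0, series (fun k => a k * (z - z0) ^+ k) @ \oo --> g z.

Definition analytic_on (R : realType) (U : set R[i]) (g : R[i] -> R[i]) :=
  forall z, U z -> analytic_at g z.

Section complex_facts.
Variable R : realType.
Implicit Types (z w : R[i]) (g : R[i] -> R[i]).

Lemma normr_normc z : `|z| = (normc z)%:C%C.
Proof. by []. Qed.

Lemma normc_ge0 z : 0 <= normc z.
Proof. by rewrite -ler0c -normr_normc normr_ge0. Qed.

Lemma normc_lt z (r : R) : (`|z| < r%:C%C) = (normc z < r).
Proof. by rewrite normr_normc ltcR. Qed.

Lemma normc_le z (r : R) : (`|z| <= r%:C%C) = (normc z <= r).
Proof. by rewrite normr_normc lecR. Qed.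

Lemma normcD z w : normc (z + w) <= normc z + normc w.
Proof. by rewrite -lecR rmorphD /= -!normr_normc ler_normD. Qed.

Lemma normc_real (r : R) : normc (r%:C%C) = `|r|.
Proof. by rewrite /ComplexField.Normc.normc /= expr0n /= addr0 sqrtr_sqr. Qed.

Lemma gt0C (e : R[i]) : 0 < e -> exists2 d : R, 0 < d & e = d%:C%C.
Proof.
case: e => a b; rewrite ltcE /= => /andP[/eqP -> a0]; by exists a.
Qed.

Lemma nearC z (P : set R[i]) :
  (\forall w \near z, P w) <->
  exists2 d : R, 0 < d & forall w, normc (w - z) < d -> P w.
Proof.
split=> [/nbhs_ballP[e /= e0 eP]|[d d0 dP]].
  have [d d0 dE] := gt0C e0; exists d => // w wz; apply: eP.
  by rewrite /ball /= distrC dE normc_lt.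
apply: (iffRL (@nbhs_ballP R[i] R[i] z P)); exists d%:C%C => /=; first by rewrite ltcR.
by move=> w; rewrite /ball /= distrC normc_lt; exact: dP.
Qed.

Lemma cvgnC (u : nat -> R[i]) l :
  (fun n => normc (u n - l)) @ \oo --> (0 : R) -> u @ \oo --> l.
Proof.
move=> ul; apply/cvgrPdist_lt => e e0; have [d d0 ->] := gt0C e0.
move/cvgrPdist_lt : ul => /(_ _ d0); apply: filterS => n.
by rewrite sub0r normrN ger0_norm ?normc_ge0// distrC normc_lt.
Qed.

Lemma cdisk_compact (r : R) : compact (cdisk r).
Proof.
pose f (p : R * R) : R[i] := (p.1 +i* p.2)%C.
have fc : continuous f.
  move=> p; apply/cvgrPdist_lt => e /gt0C [d d0 ->].
  have d20 : 0 < d / 2 by rewrite divr_gt0.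
  exists (ball p.1 (d / 2), ball p.2 (d / 2)) => /=.
    by split; exact: nbhsx_ballx.
  move=> q [/= p1 p2]; rewrite normc_lt.
  rewrite (_ : f p - f q = (p.1 - q.1)%:C%C + 'i%C * (p.2 - q.2)%:C%C); last first.
    by rewrite /f; simpc.
  rewrite (le_lt_trans (normcD _ _))// ComplexField.Normc.normcM.
  rewrite !normc_real /ComplexField.Normc.normc /= expr0n expr1n /=.
  rewrite add0r sqrtr1 mul1r.
  by rewrite (splitr d) ltrD.
have cK : compact (f @` (`[- r, r] `*` `[- r, r])).
  apply: continuous_compact; last first.
    by apply: compact_setX; exact: segment_compact.
  exact: continuous_subspaceT.
apply: (subclosed_compact _ cK).
  rewrite -openC openE => z /= /negP; rewrite -ltNge => rz.
  apply/nearC; exists (normc z - r); first by rewrite subr_gt0.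
  move=> w wz /=; apply/negP; rewrite -ltNge.
  have := normcD w (z - w); rewrite addrC subrK => h.
  have : normc (z - w) < normc z - r by rewrite -normc_lt distrC normc_lt.
  by lra.
move=> [a b] zr; exists (a, b) => //=.
have h (x y : R) : x ^+ 2 + y ^+ 2 <= r ^+ 2 -> 0 <= r -> - r <= x <= r.
  move=> xyr r0; rewrite -ler_norml -(@ler_pXn2r _ 2) ?nnegrE// real_normK ?num_real//.
  by rewrite (le_trans _ xyr)// lerDl sqr_ge0.
have r0 : 0 <= r by rewrite (le_trans (normc_ge0 _) zr).
have abr : a ^+ 2 + b ^+ 2 <= r ^+ 2.
  by rewrite -ler_sqrt ?sqr_ge0// sqrtr_sqr (ger0_norm r0).
by rewrite !in_itv /=; split; [exact: (h a b)|apply: (h b a) => //; rewrite addrC].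
Qed.

Lemma cdisk_nbhs (U : set R[i]) : open U -> cdisk 1 `<=` U ->
  exists2 d : R, 0 < d & cdisk (1 + d) `<=` U.
Proof.
move=> oU DU.
have /compact_near_coveringP cov := @cdisk_compact 1.
have : \forall e \near (0 : R)^'+,
    cdisk 1 `<=` [set z | forall w, normc (w - z) <= e -> U w].
  apply: cov => z /DU Uz.
  have : \forall w \near z, U w by rewrite openE in oU; exact: oU.
  move/nearC => [d d0 dU].
  have d20 : 0 < d / 2 by rewrite divr_gt0.
  near=> z' e => /= w wz'; apply: dU.
  have zz' : normc (z' - z) < d / 2.
    by near: z'; apply/nearC; exists (d / 2).
  have ed : e < d / 2 by near: e; exact: nbhs_right_lt.
  have := normcD (w - z') (z' - z); rewrite addrA subrK => h.
  by lra.
move=> H; near (0 : R)^'+ => e.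
have e0 : 0 < e by near: e; exact: nbhs_right_gt.
exists e => // w /= we.
have eP : cdisk 1 `<=` [set z | forall w, normc (w - z) <= e -> U w] by near: e.
have [w1|w1] := leP (normc w) 1; first by apply: DU.
have w0 : 0 < normc w by lra.
have nw : normc (w / (normc w)%:C%C) = 1.
  by rewrite ComplexField.Normc.normcM ComplexField.Normc.normcV normc_real
    (ger0_norm (normc_ge0 w)) divff// gt_eqF.
apply: (eP (w / (normc w)%:C%C)); first by rewrite /cdisk /mkset nw.
rewrite (_ : w - _ = (w / (normc w)%:C%C) * (normc w - 1)%:C%C).
  rewrite ComplexField.Normc.normcM nw mul1r normc_real ger0_norm.
    by rewrite lerBlDl.
  by rewrite subr_ge0 ltW.
rewrite rmorphB /= mulrBr mulr1 divfK//.
by rewrite (inj_eq (@complexI R)) gt_eqF.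
Unshelve. all: by end_near. Qed.

Lemma analytic_cst (c z0 : R[i]) : analytic_at (fun=> c) z0.
Proof.
exists (fun k => if k is 0 then c else 0); apply: (@nearW _ (nbhs z0)) => z.
apply: cvg_near_cst; suff h : forall n, (1 <= n)%N ->
    series (fun k => (if k is 0 then c else 0) * (z - z0) ^+ k) n = c.
  by near=> n; apply: h; near: n; exact: nbhs_infty_ge.
case=> [|n] //= _.
rewrite /series /= big_nat_recl// expr0 mulr1 big1 ?addr0// => i _.
by rewrite mul0r.
Unshelve. all: by end_near. Qed.

Lemma analytic_id (z0 : R[i]) : analytic_at id z0.
Proof.
exists (fun k => if k is 0 then z0 else (k == 1)%:R); apply: (@nearW _ (nbhs z0)) => z.
apply: cvg_near_cst; suff h : forall n, (2 <= n)%N ->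
    series (fun k => (if k is 0 then z0 else (k == 1)%:R) * (z - z0) ^+ k) n = z.
  by near=> n; apply: h; near: n; exact: nbhs_infty_ge.
case=> [|[|n]] //= _.
rewrite /series /= !big_nat_recl//= expr0 mulr1 big1 => [|i _]; last by rewrite mul0r.
by rewrite mul1r expr1 addr0 addrC subrK.
Unshelve. all: by end_near. Qed.

Lemma analyticD g1 g2 z0 : analytic_at g1 z0 -> analytic_at g2 z0 ->
  analytic_at (fun z => g1 z + g2 z) z0.
Proof.
move=> [a ga] [b gb]; exists (fun k => a k + b k).
move: ga gb => /nearC[d d0 ga] /nearC[d' d'0 gb].
apply/nearC; exists (Num.min d d') => [|z]; first by rewrite lt_min d0.
rewrite lt_min => /andP[/ga sa /gb sb].
have -> : series (fun k => (a k + b k) * (z - z0) ^+ k) =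
    (fun n => series (fun k => a k * (z - z0) ^+ k) n +
              series (fun k => b k * (z - z0) ^+ k) n).
  apply/funext => n; rewrite /series /= -big_split /=.
  by apply: eq_bigr => i _; rewrite mulrDl.
exact: (cvgD sa sb).
Qed.

Lemma analyticM_cvg (u v : nat -> R[i]) (M : R) (s t : R[i]) :
  (forall i, normc (u i) <= M * 4^-1 ^+ i) ->
  (forall i, normc (v i) <= M * 4^-1 ^+ i) ->
  series u @ \oo --> s -> series v @ \oo --> t ->
  series (fun n => \sum_(i < n.+1) u i * v (n - i)%N) @ \oo --> s * t.
Proof.
move=> uM vM us vt.
have M0 : 0 <= M.
  by have := le_trans (normc_ge0 _) (uM 0%N); rewrite expr0 mulr1.
have p0 n : 0 <= (4^-1 : R) ^+ n by rewrite exprn_ge0.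
pose w n := \sum_(i < n.+1) u i * v (n - i)%N.
have seriesS (x : nat -> R[i]) n : series x n.+1 = series x n + x n.
  by rewrite /series /= big_nat_recr.
have series1 (x : nat -> R[i]) : series x 1%N = x 0%N.
  by rewrite /series /= big_nat1.
have wE n : series w n = \sum_(0 <= i < n) u i * series v (n - i)%N.
  elim: n => [|n IH]; first by rewrite /series /= !big_geq.
  rewrite seriesS IH big_nat_recr//= subSnn series1.
  rewrite /w big_ord_recr /= subnn addrA; congr (_ + _).
  rewrite -(big_mkord xpredT (fun i => u i * v (n - i)%N)) -big_split /=.
  apply: eq_big_nat => i /andP[_ ni].
  by rewrite subSn 1?ltnW// seriesS mulrDr.
have vT m n : (m <= n)%N ->
    normc (series v n - series v m) <= 2 * M * 4^-1 ^+ m - 2 * M * 4^-1 ^+ n.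
  move=> mn; rewrite -(subnK mn); elim: (n - m)%N => [|k IH].
    by rewrite add0n !subrr ComplexField.Normc.normc0.
  rewrite addSn seriesS addrAC.
  rewrite (le_trans (normcD _ _))// (le_trans (lerD IH (vM _)))// exprS.
  have : 0 <= M * 4^-1 ^+ (k + m) by rewrite mulr_ge0.
  by set x := _ ^+ (k + m); set y := _ ^+ m; lra.
have dE n : normc (series u n * series v n - series w n) <=
    2 * M * M * (n%:R * 4^-1 ^+ n).
  rewrite wE {1}/series /= mulr_suml -sumrB.
  rewrite -normc_le (le_trans (ler_norm_sum _ _ _))//.
  have -> : (2 * M * M * (n%:R * 4^-1 ^+ n))%:C%C =
     \sum_(0 <= i < n) (2 * M * M * 4^-1 ^+ n)%:C%C :> R[i].
    rewrite sumr_const_nat subn0 -rmorphMn /=; congr (_%:C)%C.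
    by rewrite -mulr_natl; ring.
  rewrite big_nat [leRHS]big_nat; apply: ler_sum => i /andP[_ ni].
  rewrite -mulrBr normc_le ComplexField.Normc.normcM.
  have h := vT (n - i)%N n (leq_subr _ _).
  have : normc (series v n - series v (n - i)%N) <= 2 * M * 4^-1 ^+ (n - i).
    by rewrite (le_trans h)// gerBl mulr_ge0// mulr_ge0.
  move=> h'; rewrite (le_trans (ler_pM (normc_ge0 _) (normc_ge0 _) (uM i) h'))//.
  rewrite -{2}(subnKC (ltnW ni)) exprD.
  by rewrite le_eqVlt; apply/orP; left; apply/eqP; ring.
have nE n : n%:R * 4^-1 ^+ n <= 2^-1 ^+ n :> R.
  rewrite (_ : 4^-1 = 2^-1 * 2^-1 :> R); last by rewrite -invfM -natrM.
  rewrite exprMn mulrA -[leRHS]mul1r ler_wpM2r ?exprn_ge0//.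
  by rewrite exprVn ler_pdivrMr ?exprn_gt0// mul1r -natrX ler_nat ltnW// ltn_expl.
have d0 : (fun n => series u n * series v n - series w n) @ \oo --> (0 : R[i]).
  apply: cvgnC; under eq_fun do rewrite subr0.
  apply: (@squeeze_cvgr _ _ _ _ (cst 0) (fun n => 2 * M * M * 2^-1 ^+ n)).
  - apply: nearW => n /=; rewrite normc_ge0 /= (le_trans (dE n))//.
    by rewrite ler_wpM2l// !mulr_ge0.
  - exact: cvg_cst.
  - rewrite -[X in _ --> X](mulr0 (2 * M * M)); apply: cvgM; first exact: cvg_cst.
    by apply: cvg_expr; rewrite ger0_norm// invf_lt1// ltr1n.
have -> : series w = fun n => series u n * series v n -
    (series u n * series v n - series w n).
  by apply/funext => n; rewrite subKr.
have uv : (fun n => series u n * series v n) @ \oo --> s * t.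
  exact: (cvgM us vt).
rewrite -[s * t]subr0; exact: (cvgB uv d0).
Qed.

(* A power series converging near [z0] has geometrically bounded terms on a
   smaller disk, in the form required by [analyticM_cvg]. *)
Lemma analytic_bound g z0 (a : nat -> R[i]) :
  (\forall z \near z0, series (fun k => a k * (z - z0) ^+ k) @ \oo --> g z) ->
  exists2 M : R, 0 <= M & \forall z \near z0,
    forall k, normc (a k * (z - z0) ^+ k) <= M * 4^-1 ^+ k.
Proof.
move=> /nearC [d d0 dg].
have d20 : 0 < d / 2 by rewrite divr_gt0.
have /cvgP/cvg_series_cvg_0/cvgP/cvg_seq_bounded :
    series (fun k => a k * ((d / 2)%:C%C) ^+ k) @ \oo --> g (z0 + (d / 2)%:C%C).
  have := dg (z0 + (d / 2)%:C%C).
  rewrite (addrC z0) addrK normc_real gtr0_norm//; apply.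
  by rewrite ltr_pdivrMr// ltr_pMr// ltr1n.
move=> /pinfty_ex_gt0[_ /gt0C[M M0 ->] /= aM].
exists M; first exact: ltW.
apply/nearC; exists (d / 2 / 4); first by rewrite divr_gt0.
move=> z zz0 k.
have ad : normc (a k) * (d / 2) ^+ k <= M.
  have /= := aM k Logic.I; rewrite normc_le ComplexField.Normc.normcM -rmorphXn /=.
  by rewrite normc_real ger0_norm// exprn_ge0// ltW.
have nX : normc ((z - z0) ^+ k) <= (d / 2) ^+ k * 4^-1 ^+ k.
  rewrite -normc_le normrX -exprMn rmorphXn /= lerXn2r ?nnegrE ?normr_ge0//.
    by rewrite ler0c mulr_ge0// ltW.
  by rewrite normc_le ltW.
rewrite ComplexField.Normc.normcM (le_trans (ler_wpM2l (normc_ge0 _) nX))//.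
by rewrite mulrA ler_wpM2r// exprn_ge0.
Qed.

Lemma analyticM g1 g2 z0 : analytic_at g1 z0 -> analytic_at g2 z0 ->
  analytic_at (fun z => g1 z * g2 z) z0.
Proof.
move=> [a ga] [b gb]; exists (fun k => \sum_(i < k.+1) a i * b (k - i)%N).
have [M M0 aM] := analytic_bound ga; have [N N0 bN] := analytic_bound gb.
move: aM bN ga gb => /nearC[d1 e1 aM] /nearC[d2 e2 bN] /nearC[d3 e3 ga] /nearC[d4 e4 gb].
apply/nearC; exists (Num.min (Num.min d1 d2) (Num.min d3 d4)).
  by rewrite !lt_min e1 e2 e3.
move=> z; rewrite !lt_min => /andP[/andP[/aM ha /bN hb] /andP[/ga sa /gb sb]].
have -> : (fun k => (\sum_(i < k.+1) a i * b (k - i)%N) * (z - z0) ^+ k) =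
    (fun k => \sum_(i < k.+1) (a i * (z - z0) ^+ i) * (b (k - i)%N * (z - z0) ^+ (k - i))).
  apply/funext => k; rewrite mulr_suml; apply: eq_bigr => i _.
  have ik : (i <= k)%N by rewrite -ltnS.
  rewrite mulrACA -exprD subnKC//.
apply: (@analyticM_cvg (fun i => a i * (z - z0) ^+ i)
   (fun i => b i * (z - z0) ^+ i) (Num.max M N)).
- move=> i; by rewrite (le_trans (ha i))// ler_wpM2r ?exprn_ge0// le_max lexx.
- move=> i; by rewrite (le_trans (hb i))// ler_wpM2r ?exprn_ge0// le_max lexx orbT.
- exact: sa.
- exact: sb.
Qed.

Lemma analyticV (c z0 : R[i]) : 1 - c * z0 != 0 ->
  analytic_at (fun z => (1 - c * z)^-1) z0.
Proof.
set e := 1 - c * z0 => e0.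
exists (fun k => e^-1 * (c / e) ^+ k).
have n0 : 0 < normc (c / e) + 1 by rewrite ltr_wpDl// normc_ge0.
apply/nearC; exists ((normc (c / e) + 1)^-1); first by rewrite invr_gt0.
move=> z zz0; set q := c / e * (z - z0).
have q1 : normc q < 1.
  rewrite ComplexField.Normc.normcM.
  apply: (@le_lt_trans _ _ ((normc (c / e) + 1) * normc (z - z0))).
    by rewrite ler_wpM2r ?normc_ge0// lerDl.
  by rewrite -ltr_pdivlMl// mulr1.
have qn1 : q != 1.
  by apply: contraTneq q1 => ->; rewrite ComplexField.Normc.normc1 ltxx.
have -> : (fun k => e^-1 * (c / e) ^+ k * (z - z0) ^+ k) = geometric (e^-1) q.
  by apply/funext => k; rewrite /= -mulrA -exprMn.
rewrite geometric_seriesE//.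
have -> : (1 - c * z)^-1 = e^-1 * (1 - 0) / (1 - q).
  rewrite subr0 mulr1 -invfM; congr (_^-1); rewrite mulrBr mulr1 /q mulrA.
  by rewrite (mulrC e) divfK// /e; ring.
have q0 : (fun n => q ^+ n) @ \oo --> (0 : R[i]).
  apply: cvgnC; under eq_fun do rewrite subr0.
  have -> : (fun n => normc (q ^+ n)) = (fun n => normc q ^+ n).
    apply/funext => n; apply: (@complexI R).
    by rewrite rmorphXn /= -!normr_normc normrX.
  by apply: cvg_expr; rewrite ger0_norm// normc_ge0.
have q1' : (fun n => 1 - q ^+ n) @ \oo --> (1 - 0 : R[i]).
  exact: (cvgB (cvg_cst (1 : R[i])) q0).
have q2 : (fun n => e^-1 * (1 - q ^+ n)) @ \oo --> e^-1 * (1 - 0).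
  exact: (cvgM (cvg_cst e^-1) q1').
exact: (cvgM q2 (cvg_cst (1 - q)^-1)).
Qed.

Lemma analyticZ c g z0 : analytic_at g z0 -> analytic_at (fun z => c * g z) z0.
Proof. by move=> ag; apply: analyticM ag; exact: analytic_cst. Qed.

End complex_facts.

(* A germ along the closed unit disk is determined by its restriction to that
   disk, so Hol(closed disk) is the space of functions on the closed unit disk
   having an analytic extension to an open neighbourhood of it. *)
Definition closed_disk (R : realType) := {z : R[i] | normc z <= 1}.

Definition extends (R : realType) (g : R[i] -> R[i])
    (f : closed_disk R -> R[i]) := forall z, f z = g (val z).

Definition hol_pred (R : realType) : {pred closed_disk R -> R[i]} :=
  [pred f : closed_disk R -> R[i] | `[< exists (U : set R[i]) (g : R[i] -> R[i]),
    [/\ open U, cdisk 1 `<=` U, analytic_on U g & extends g f] >] ].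

Record hol (R : realType) := Hol {
  hol_fun :> closed_disk R -> R[i];
  holP : hol_fun \in @hol_pred R }.

HB.instance Definition _ (R : realType) := [isSub for @hol_fun R].
HB.instance Definition _ (R : realType) := [Choice of hol R by <:].

Lemma hol_submod (R : realType) : GRing.subsemimod_closed (@hol_pred R).
Proof.
split; first split.
- apply/asboolP; exists setT, (fun=> 0); split=> //; first exact: openT.
  by move=> z _; exact: analytic_cst.
- move=> f1 f2 /asboolP[U1 [g1 [oU1 DU1 ag1 fg1]]].
  move=> /asboolP[U2 [g2 [oU2 DU2 ag2 fg2]]].
  apply/asboolP; exists (U1 `&` U2), (fun z => g1 z + g2 z); split.
  + exact: openI.
  + by move=> z Dz; split; [exact: DU1|exact: DU2].
  + by move=> z [U1z U2z]; apply: analyticD; [exact: ag1|exact: ag2].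
  + by move=> z; rewrite -fg1 -fg2.
- move=> c f /asboolP[U [g [oU DU ag fg]]].
  apply/asboolP; exists U, (fun z => c * g z); split.
  + exact: oU.
  + exact: DU.
  + by move=> z Uz; apply: analyticZ; exact: ag.
  + by move=> z; rewrite -fg.
Qed.

HB.instance Definition _ (R : realType) :=
  GRing.isSubSemiModClosed.Build R[i] (closed_disk R -> R[i]) (@hol_pred R) (@hol_submod R).
HB.instance Definition _ (R : realType) :=
  [SubChoice_isSubLmodule of hol R by <:].

(* A(rD): the ambient values of [g] outside the closed disk play no role. *)
Definition disk_algebra (R : realType) (r : R) (g : R[i] -> R[i]) :=
  analytic_on (disk r) g /\ {within cdisk r, continuous g}.

Definition sup_norm (R : realType) (r : R) (g : R[i] -> R[i]) : \bar R :=
  ereal_sup [set (normc (g z))%:E | z in disk r].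

Definition radius (R : realType) (n : nat) : R := 1 + n%:R^-1.

Definition absolutely_convex (R : realType) (E : lmodType R[i]) (V : set E) :=
  forall x y a b, V x -> V y -> normc a + normc b <= 1 -> V (a *: x + b *: y).

(* Basic neighbourhoods of 0 for the locally convex inductive limit topology:
   nonempty absolutely convex sets whose preimage in each A(r_n D), n >= 1, is
   a neighbourhood of 0 for the sup norm. *)
Definition hol_nbhs0 (R : realType) (V : set (hol R)) :=
  [/\ V !=set0, absolutely_convex V & forall n, (0 < n)%N ->
    exists2 e : R, 0 < e & forall (g : R[i] -> R[i]) (f : hol R),
      disk_algebra (radius R n) g -> (sup_norm (radius R n) g < e%:E)%E ->
      extends g f -> V f].

Definition hol_nbhs (R : realType) (f : hol R) : set_system (hol R) :=
  [set A | exists2 V, hol_nbhs0 V & forall h, V h -> A (f + h)].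

Section hol_topology.
Variable R : realType.
Implicit Types (f h : hol R) (g : R[i] -> R[i]) (V : set (hol R)) (c : R[i]).

Lemma hol_nbhs0_0 V : hol_nbhs0 V -> V 0.
Proof.
move=> [[x Vx] aV _]; rewrite -(addr0 0) -(scale0r x).
by apply: aV; rewrite // ComplexField.Normc.normc0 addr0.
Qed.

Lemma hol_nbhs0T : hol_nbhs0 (setT : set (hol R)).
Proof. by split => [|//|n n0]; [exists 0|exists 1]. Qed.

Lemma hol_nbhs0I V W : hol_nbhs0 V -> hol_nbhs0 W -> hol_nbhs0 (V `&` W).
Proof.
move=> bV bW; have V0 := hol_nbhs0_0 bV; have W0 := hol_nbhs0_0 bW.
case: bV bW => _ aV nV [_ aW nW]; split.
- by exists 0.
- by move=> x y a b [? ?] [? ?] ab; split; [exact: aV|exact: aW].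
- move=> n n0; have [e e0 eV] := nV n n0; have [d d0 dW] := nW n n0.
  exists (Num.min e d); first by rewrite lt_min e0.
  move=> g f ag; rewrite EFin_min lt_min => /andP[ge gd] gf.
  by split; [exact: eV gf|exact: dW gf].
Qed.

Lemma sup_normP (r e : R) g :
  (forall z, disk r z -> normc (g z) <= e) -> (sup_norm r g <= e%:E)%E.
Proof. by move=> ge; apply: ge_ereal_sup => _ [z rz <-]; rewrite lee_fin ge. Qed.

Lemma sup_norm_lt (r e : R) g z :
  (sup_norm r g < e%:E)%E -> disk r z -> normc (g z) < e.
Proof.
move=> ge rz; rewrite -lte_fin; apply: le_lt_trans ge.
by apply: ereal_sup_ubound; exists z.
Qed.

Lemma disk_algebraZ (r : R) c g :
  disk_algebra r g -> disk_algebra r (fun z => c * g z).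
Proof.
move=> [ag cg]; split; first by move=> z rz; apply: analyticZ; exact: ag.
move=> z; exact: (cvgM (cvg_cst c) (cg z)).
Qed.

Lemma hol_nbhs0Z V c : hol_nbhs0 V -> hol_nbhs0 [set f | V (c *: f)].
Proof.
move=> bV; have V0 := hol_nbhs0_0 bV; case: bV => _ aV nV; split.
- by exists 0; rewrite /= scaler0.
- move=> x y a b /= Vx Vy ab; rewrite scalerDr !scalerA !(mulrC c) -!scalerA.
  exact: aV.
- move=> n n0; have [e e0 eV] := nV n n0.
  have c0 : 0 < normc c + 1 by rewrite ltr_wpDl// normc_ge0.
  exists (e / (normc c + 1)); first by rewrite divr_gt0.
  move=> g f ag ge gf /=; apply: (eV (fun z => c * g z)).
  + exact: disk_algebraZ.
  + have h : normc c * (e / (normc c + 1)) < e.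
      rewrite mulrCA -[ltRHS]mulr1 ltr_pM2l// ltr_pdivrMr// mul1r.
      by rewrite ltrDl.
    apply: (@le_lt_trans _ _ (normc c * (e / (normc c + 1)))%:E).
      apply: sup_normP => z rz; rewrite ComplexField.Normc.normcM.
      by rewrite ler_wpM2l ?normc_ge0// ltW// (sup_norm_lt ge).
    by rewrite lte_fin.
  + by move=> z; rewrite -gf.
Qed.

Lemma analytic_continuous g z0 : analytic_at g z0 -> {for z0, continuous g}.
Proof.
move=> [a ga]; have [M M0 aM] := analytic_bound ga.
move: ga aM => /nearC[d1 d10 ga] /nearC[d2 d20 aM].
pose p := Num.min d1 d2 / 2.
have p0 : 0 < p by rewrite divr_gt0// lt_min d10.
have [pd1 pd2] : p < d1 /\ p < d2.
  apply/andP; rewrite -lt_min /p ltr_pdivrMr// ltr_pMr ?ltr1n//.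
  by rewrite lt_min d10.
have ap k : normc (a k) * p ^+ k <= M * 4^-1 ^+ k.
  have := aM (z0 + p%:C%C); rewrite (addrC z0) addrK normc_real gtr0_norm//.
  move=> /(_ pd2 k); rewrite ComplexField.Normc.normcM -rmorphXn /= normc_real.
  by rewrite ger0_norm// exprn_ge0// ltW.
have main z s e : 0 < s -> s <= 1 -> 0 < e -> normc (z - z0) <= p * s ->
    normc (g z - a 0%N) < e + s * M.
  move=> s0 s1 e0 zs.
  have zp : normc (z - z0) <= p by rewrite (le_trans zs)// ler_piMr// ltW.
  have gz := ga z (le_lt_trans zp pd1).
  have sM n : normc (series (fun k => a k * (z - z0) ^+ k) n.+1 - a 0%N) <=
      s * M - s * M * 4^-1 ^+ n.
    elim: n => [|n IH].
      rewrite /series /= big_nat1 !expr0 !mulr1 !subrr.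
      by rewrite ComplexField.Normc.normc0.
    rewrite /series /= big_nat_recr//= addrAC.
    rewrite (le_trans (normcD _ _))// (le_trans (lerD IH (lexx _)))//.
    have : normc (a n.+1 * (z - z0) ^+ n.+1) <= s * (M * 4^-1 ^+ n.+1).
      rewrite ComplexField.Normc.normcM.
      have : normc ((z - z0) ^+ n.+1) <= p ^+ n.+1 * s.
        rewrite -normc_le normrX rmorphM rmorphXn /=.
        have zp' : `|z - z0| <= p%:C%C by rewrite normc_le.
        rewrite exprSr [p%:C%C ^+ _]exprSr -mulrA ler_pM ?exprn_ge0 ?normr_ge0//.
          by rewrite lerXn2r ?nnegrE ?normr_ge0// ler0c ltW.
        by rewrite -rmorphM normc_le.
      move=> h; rewrite (le_trans (ler_wpM2l (normc_ge0 _) h))//.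
      by rewrite mulrA mulrC ler_wpM2l// ltW.
    have : 0 <= s * M * 4^-1 ^+ n by rewrite !mulr_ge0 ?exprn_ge0// ltW.
    rewrite !exprS; set x := _ ^+ n; lra.
  move/cvgrPdist_lt : gz => /(_ e%:C%C); rewrite ltcR => /(_ e0)[n _ nz].
  have := nz n.+1 (leqnSn n); rewrite normc_lt => gn.
  rewrite (_ : g z - a 0%N = (g z - series (fun k => a k * (z - z0) ^+ k) n.+1) +
    (series (fun k => a k * (z - z0) ^+ k) n.+1 - a 0%N)); last first.
    by rewrite addrA subrK.
  rewrite (le_lt_trans (normcD _ _))// ltr_leD// (le_trans (sM n))//.
  by rewrite gerBl !mulr_ge0 ?exprn_ge0// ltW.
apply: (iffRL (@cvgrPdist_lt _ _ _ (nbhs z0) _ g (g z0))) => _ /gt0C[e e0 ->].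
apply/nearC.
pose s := Num.min 1 (e / 4 / (M + 1)).
have M1 : 0 < M + 1 by rewrite ltr_wpDl.
have e4 : 0 < e / 4 by rewrite divr_gt0.
have s0 : 0 < s by rewrite lt_min ltr01 divr_gt0.
have s1 : s <= 1 by rewrite ge_min lexx.
have sM : s * M <= e / 4.
  rewrite (@le_trans _ _ (e / 4 / (M + 1) * M))//.
    by rewrite ler_wpM2r// ge_min lexx orbT.
  by rewrite -mulrA ler_piMr ?(ltW e4)// mulrC ler_pdivrMr// mul1r lerDl.
exists (p * s); first by rewrite mulr_gt0.
move=> z zs; rewrite normc_lt.
have hz := main z s (e / 4) s0 s1 e4 (ltW zs).
have hz0 : normc (g z0 - a 0%N) < e / 4 + s * M.
  by apply: main => //; rewrite subrr ComplexField.Normc.normc0 mulr_ge0// ltW.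
have -> : g z0 - g z = (g z0 - a 0%N) + (a 0%N - g z) by rewrite addrA subrK.
have hz' : normc (a 0%N - g z) < e / 4 + s * M.
  by rewrite -normc_lt distrC normc_lt.
by rewrite (le_lt_trans (normcD _ _))//; lra.
Qed.

Lemma hol_step f : exists2 n, (0 < n)%N &
  exists g, disk_algebra (radius R n) g /\ extends g f.
Proof.
have /asboolP[U [g [oU DU ag fg]]] := holP f.
have [d d0 dU] := cdisk_nbhs oU DU.
pose n := (Num.truncn d^-1).+1.
have nd : n%:R^-1 <= d.
  rewrite -[leRHS]invrK lef_pV2 ?posrE ?invr_gt0// ltW//.
  exact: truncnS_gt.
have rU : cdisk (radius R n) `<=` U.
  move=> z zn; apply: dU; rewrite /cdisk/= (le_trans zn)//.
  by rewrite /radius lerD2l.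
exists n => //; exists g; split; last exact: fg.
split; first by move=> z zn; apply: ag; apply: rU; exact: ltW.
apply: continuous_in_subspaceT => z /set_mem /rU Uz.
by apply: analytic_continuous; exact: ag.
Qed.

Lemma disk_algebra_bounded (r : R) g : disk_algebra r g ->
  exists2 M : R, 0 < M & forall z, cdisk r z -> normc (g z) <= M.
Proof.
move=> [_ cg]; have cK := continuous_compact cg (@cdisk_compact R r).
have nc : continuous (fun z : R[i] => normc z).
  move=> z; apply: (iffRL (@cvgrPdist_lt _ _ _ (nbhs z) _ (fun z : R[i] => normc z) (normc z))) => e e0.
  apply/nearC; exists e => // w wz.
  have h1 := normcD (z - w) w; have h2 := normcD (w - z) z.
  rewrite !subrK in h1 h2.
  have h3 : normc (z - w) = normc (w - z).
    by apply: (@complexI R); rewrite -!normr_normc distrC.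
  by rewrite ltr_norml; apply/andP; split; lra.
have := continuous_compact (continuous_subspaceT nc) cK.
move=> /compact_bounded/pinfty_ex_gt0[M M0 /= gM].
exists M => // z rz.
have := gM (normc (g z)); rewrite ger0_norm ?normc_ge0//; apply.
by exists (g z) => //; exists z.
Qed.

Lemma hol_absorbing V f : hol_nbhs0 V -> exists2 t : R, 0 < t & V (t%:C%C *: f).
Proof.
move=> [_ _ nV]; have [n n0 [g [ag gf]]] := hol_step f.
have [e e0 eV] := nV n n0; have [M M0 gM] := disk_algebra_bounded ag.
exists (e / 2 / M); first by rewrite !divr_gt0.
apply: (eV (fun z => (e / 2 / M)%:C%C * g z)).
- exact: disk_algebraZ.
- apply: (@le_lt_trans _ _ (e / 2)%:E).
    apply: sup_normP => z rz; rewrite ComplexField.Normc.normcM normc_real.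
    rewrite gtr0_norm ?divr_gt0// mulrAC ler_pdivrMr// ler_pM2l ?divr_gt0//.
    by apply: gM; exact: ltW.
  by rewrite lte_fin ltr_pdivrMr// ltr_pMr// ltr1n.
- by move=> z; rewrite -gf.
Qed.

Lemma hol_nbhs0_half V x y : hol_nbhs0 V -> V (2 *: x) -> V (2 *: y) -> V (x + y).
Proof.
move=> [_ aV _] Vx Vy.
have n2 : normc (2^-1 : R[i]) = 2^-1.
  by rewrite (_ : 2^-1 = (2^-1)%:C%C) ?normc_real ?ger0_norm// fmorphV rmorph_nat.
have := aV _ _ 2^-1 2^-1 Vx Vy.
rewrite !scalerA mulVf ?pnatr_eq0// !scale1r; apply.
by rewrite n2; lra.
Qed.

Lemma hol_nbhs_filter f : ProperFilter (hol_nbhs f).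
Proof.
split.
  by move=> [V bV]; apply; exact: (hol_nbhs0_0 bV).
split.
- by exists setT => //; exact: hol_nbhs0T.
- move=> A B [V bV VA] [W bW WB]; exists (V `&` W); first exact: hol_nbhs0I.
  by move=> h [Vh Wh]; split; [exact: VA|exact: WB].
- by move=> A B AB [V bV VA]; exists V => // h /VA; exact: AB.
Qed.

Lemma hol_nbhs_singleton f (A : set (hol R)) : hol_nbhs f A -> A f.
Proof. by move=> [V bV VA]; rewrite -(addr0 f); apply: VA; exact: hol_nbhs0_0. Qed.

Lemma hol_nbhs_nbhs f (A : set (hol R)) :
  hol_nbhs f A -> hol_nbhs f (fun h => hol_nbhs h A).
Proof.
move=> [V bV VA]; exists [set h | V (2 *: h)]; first exact: hol_nbhs0Z.
move=> h Vh; exists [set h | V (2 *: h)]; first exact: hol_nbhs0Z.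
by move=> k Vk; rewrite -addrA; apply: VA; exact: hol_nbhs0_half.
Qed.

End hol_topology.

HB.instance Definition _ (R : realType) := hasNbhs.Build (hol R) (@hol_nbhs R).
HB.instance Definition _ (R : realType) := Nbhs_isNbhsTopological.Build (hol R)
  (@hol_nbhs_filter R) (@hol_nbhs_singleton R) (@hol_nbhs_nbhs R).

Section hol_tvs.
Variable R : realType.

Lemma hol_add_continuous : continuous (fun x : hol R * hol R => x.1 + x.2).
Proof.
move=> [f h] A [V bV VA]; have bV2 := hol_nbhs0Z 2 bV.
exists ([set f + k | k in [set k | V (2 *: k)]],
        [set h + k | k in [set k | V (2 *: k)]]).
  by split; (exists [set k | V (2 *: k)]; [exact: bV2|move=> k Vk; exists k]).
move=> [_ _] [/= [k Vk <-] [l Vl <-]]; rewrite addrACA; apply: VA.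
exact: hol_nbhs0_half.
Qed.

Lemma hol_scale_continuous : continuous (fun x : R[i]^o * hol R => x.1 *: x.2).
Proof.
move=> [a f] A [V bV VA].
have [t t0 Vt] := hol_absorbing f bV.
pose m : R := 2 * (normc a + 1).
have m0 : 0 < m by rewrite mulr_gt0// ltr_wpDl// normc_ge0.
pose d : R := Num.min 1 (t / 2).
have d0 : 0 < d by rewrite lt_min ltr01 divr_gt0.
exists ([set z | normc (z - a) < d], [set f + k | k in [set k | V (m%:C%C *: k)]]).
  split => /=; first by apply/nearC; exists d.
  by exists [set k | V (m%:C%C *: k)]; [exact: hol_nbhs0Z|move=> k Vk; exists k].
move=> [z _] [/= + [k Vk <-]]; rewrite lt_min => /andP[za1 zat].
rewrite (_ : z *: (f + k) = a *: f + (z *: k + (z - a) *: f)); last first.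
  by rewrite scalerDr scalerBl addrCA (addrC (a *: f)) subrK addrC.
apply: VA.
have zm : normc z <= normc a + 1.
  have := normcD (z - a) a; rewrite subrK => h.
  by rewrite (le_trans h)// addrC lerD2l ltW.
have C0 (x : R) : 0 < x -> x%:C%C != 0 by move=> x0; rewrite (inj_eq (@complexI R)) gt_eqF.
rewrite (_ : z *: k = (z / m%:C%C) *: (m%:C%C *: k)); last first.
  by rewrite scalerA divfK// C0.
rewrite (_ : (z - a) *: f = ((z - a) / t%:C%C) *: (t%:C%C *: f)); last first.
  by rewrite scalerA divfK// C0.
have [_ aV _] := bV; apply: aV => //.
rewrite !ComplexField.Normc.normcM !ComplexField.Normc.normcV !normc_real !gtr0_norm//.
have h1 : normc z / m <= 2^-1.
  by rewrite ler_pdivrMr// /m mulKf// pnatr_eq0.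
have h2 : normc (z - a) / t <= 2^-1.
  by rewrite ler_pdivrMr// mulrC ltW.
by lra.
Qed.

Lemma hol_locally_convex : exists2 B : set_system (hol R),
  (forall b, b \in B -> convex_set b) & basis B.
Proof.
exists [set U : set (hol R) | open U /\ convex_set U].
  by move=> U /set_mem[].
split; first by move=> U [].
move=> f A [V bV VA].
pose U : set (hol R) := [set h | V (h - f)].
have fU : nbhs f U.
  by exists V => // h Vh; rewrite /U /= addrAC subrr add0r.
exists (interior U); last first.
  by move=> h /interior_subset Uh; rewrite -(subrK f h) addrC; exact: VA.
split; last exact: fU.
split; first exact: open_interior.
move=> x y l /set_mem[V1 bV1 V1U] /set_mem[V2 bV2 V2U]; apply/mem_set.
exists (V1 `&` V2); first exact: hol_nbhs0I.
move=> h [V1h V2h]; rewrite /U /=.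
have [_ aV _] := bV.
pose p : R[i] := l%:num.
have [p0 p1] : 0 <= p /\ p <= 1 by split; rewrite /p.
have -> : conv l x y + h - f = p *: (x + h - f) + (1 - p) *: (y + h - f) :> hol R.
  change (conv l x y) with (p *: (x : hol R) + (1 - p) *: (y : hol R)).
  rewrite -!addrA [in RHS]scalerDr [X in _ = _ + X]scalerDr [RHS]addrACA -addrA.
  by rewrite -[in RHS]scalerDl (addrC p) subrK scale1r.
apply: aV; [exact: V1U|exact: V2U|].
rewrite -lecR rmorphD /= -!normr_normc !ger0_norm ?subr_ge0//.
by rewrite addrC subrK.
Qed.

End hol_tvs.

HB.instance Definition _ (R : realType) :=
  PreTopologicalNmodule_isTopologicalNmodule.Build (hol R) (@hol_add_continuous R).
HB.instance Definition _ (R : realType) :=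
  TopologicalNmodule_isTopologicalLmodule.Build R[i] (hol R) (@hol_scale_continuous R).
(* This factory only yields the uniform structure, not the Tvs mixin. *)
HB.instance Definition _ (R : realType) :=
  PreTopologicalLmod_isTvs.Build R[i] (hol R)
    (@hol_add_continuous R) (@hol_scale_continuous R) (@hol_locally_convex R).
HB.instance Definition _ (R : realType) :=
  Uniform_isTvs.Build R[i] (hol R) (@hol_locally_convex R).

Definition schauder_basis (R : realType) (X : topologicalLmodType R[i])
    (x : nat -> X) :=
  forall y : X, exists! a : nat -> R[i],
    series (fun n => a n *: x n) @ \oo --> y.

Definition blaschke (R : realType) (lam : nat -> R[i]) (n : nat) (z : R[i]) : R[i] :=
  \prod_(1 <= k < n.+1) ((lam k - z) / (1 - (lam k)^* * z)).

Lemma blaschke_analytic (R : realType) (lam : nat -> R[i]) (n : nat) :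
  (forall n, (1 <= n)%N -> normc (lam n) < 1) ->
  exists U, [/\ open U, cdisk 1 `<=` U & analytic_on U (blaschke lam n)].
Proof.
move=> lam1; elim: n => [|n [U [oU DU aU]]].
  exists setT; split; [exact: openT|by []|move=> z _].
  rewrite (_ : blaschke lam 0 = fun=> 1); first exact: analytic_cst.
  by apply/funext => w; rewrite /blaschke big_geq.
set c := (lam n.+1)^*.
have c1 : normc c < 1.
  have := lam1 n.+1 (ltn0Sn n); rewrite /c; set l := lam _.
  by rewrite -!normc_lt norm_conjC.
pose W : set R[i] := [set z | 1 - c * z != 0].
exists (U `&` W); split.
- apply: openI => //; rewrite openE => z Wz.
  have n0 : 0 < normc (1 - c * z).
    rewrite lt_neqAle normc_ge0 andbT eq_sym.
    by apply: contraNneq Wz => /ComplexField.Normc.eq0_normc ->.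
  have c0 : 0 < normc c + 1 by rewrite ltr_wpDl// normc_ge0.
  apply/nearC; exists (normc (1 - c * z) / (normc c + 1)); first by rewrite divr_gt0.
  move=> w wz; rewrite /W /=; apply/eqP => w0; move: wz; apply/negP; rewrite -leNgt.
  rewrite ler_pdivrMr// (_ : 1 - c * z = (w - z) * c); last first.
    by rewrite -[LHS]subr0 -[X in _ - X = _]w0; ring.
  by rewrite ComplexField.Normc.normcM ler_wpM2l ?normc_ge0// lerDl.
- move=> z Dz; split; first exact: DU.
  rewrite /W /= subr_eq0; apply: contraTneq c1 => cz; rewrite -leNgt.
  rewrite -(@ComplexField.Normc.normc1 R) cz ComplexField.Normc.normcM.
  by rewrite ler_piMr ?normc_ge0.
- move=> z [Uz Wz].
  rewrite (_ : blaschke lam n.+1 = fun z =>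
      blaschke lam n z * ((lam n.+1 + (-1) * z) * (1 - c * z)^-1)); last first.
    by apply/funext => w; rewrite /blaschke big_nat_recr//= mulN1r.
  apply: (analyticM (aU z Uz)); apply: analyticM; last exact: analyticV.
  apply: analyticD; first exact: analytic_cst.
  by apply: analyticZ; exact: analytic_id.
Qed.

Lemma blaschke_subproof (R : realType) (lam : nat -> R[i]) (n : nat) :
  (forall n, (1 <= n)%N -> normc (lam n) < 1) ->
  (fun z : closed_disk R => blaschke lam n (val z)) \in @hol_pred R.
Proof.
move=> lam1; have [U [oU DU aU]] := blaschke_analytic n lam1.
by apply/asboolP; exists U, (blaschke lam n).
Qed.

(* B_n as an element of Hol(closed disk); [lam 0] is not used. *)
Definition blaschke_hol (R : realType) (lam : nat -> R[i])
    (lam1 : forall n, (1 <= n)%N -> normc (lam n) < 1) (n : nat) : hol R :=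
  Hol (blaschke_subproof n lam1).

(* Main.v *)
Require Import Defs.
From mathcomp Require Import all_boot all_order all_algebra.
From mathcomp Require Import complex ring lra.
From mathcomp Require Import all_classical all_reals all_analysis.
Import Order.TTheory GRing.Theory Num.Theory.
Import numFieldNormedType.Exports.
Local Open Scope classical_set_scope.
Local Open Scope ring_scope.
Set Implicit Arguments.
Unset Strict Implicit.
Unset Printing Implicit Defensive.
Import ComplexField.Normc Defs.

(** The Cauchy theory of a disk is obtained from averages over roots of unity,
    which play the role of contour integrals: [cmean N r g] is the mean of [g]
    over the points [r w^k], where [w] is a root of unity of order [N.+3].  It
    rests on the mean value property [cmean_cvg]: if [g] is analytic near the
    closed disk of radius [r], these means tend to [g 0].  The reason is that
    second divided differences of an analytic function are locally bounded.
    Apply this at a point [z] of a polar grid, to its neighbour [x] along the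
    circle and its neighbour [y] along the radius: [(y - z) (g x - g z)] and
    [(x - z) (g y - g z)] agree up to third order terms.  Summed over a circle
    the former telescopes to zero, so that the means over two consecutive
    circles differ by a second order term, and adding these errors up from the
    center to radius [r] leaves something that vanishes in the limit.  Division
    of [g x - g z] by [x - z] inside analytic functions ([analytic_factor])
    then gives the Cauchy formula [cmean_cauchy], a maximum principle up to a
    constant ([cauchy_bound]), and Taylor coefficients with Cauchy estimates.

    Sufficiency.  Let all [lam n] lie in the disk of radius [rho < 1].
    Evaluating at [lam 1], dividing by the first factor, evaluating at [lam 2]
    and so on writes [g] as the sum of the [a k B_k], [k < n], plus [B_n F_n].
    Write the Cauchy formula for [F_n / (1 - (lam n)^* x)] on a circle of radius
    [r > 1].  There [F_n] may be replaced by [g / B_n], because the functions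
    [B_k / (B_n (1 - (lam n)^* x))] with [k < n] are analytic outside the disk
    and vanish at infinity, so that they do not contribute.  On that circle
    [|B_n| >= kappa ^ n] with [kappa > 1], so [F_n] is of order [kappa^-n];
    on a disk only slightly larger than the unit disk [|B_n| <= K ^ n] with
    [K < kappa], hence [B_n F_n] tends to zero there.  Uniqueness holds because
    convergence in Hol is uniform on the unit circle, where the factors have
    modulus one: the value at [lam 1] gives the first coefficient, and the first
    factor can be removed without spoiling uniform convergence.

    Necessity.  Choose [y = 1 / (1 - nu x)] whose pole differs from all poles of
    the [B_n]; then [y] is not a finite combination of the [B_n], so infinitely
    many of its coefficients [a n] are nonzero.  If the [lam n] accumulated at
    the unit circle, the nonzero terms [a n B_n] would have poles closer and
    closer to the circle, and for each [m] one could pick [n >= m] and [j] such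
    that the [j]-th Taylor coefficient of [a n B_n] exceeds [r_m^-j] in modulus, with
    [r_m = 1 + 1 / m].  By the Cauchy estimates the functions whose chosen
    coefficients are all at most [r_m^-j] form a neighbourhood of zero for the
    inductive limit topology, yet infinitely many terms of a convergent series
    stay outside of it. *)

(** * The modulus of complex numbers *)

Section modulus.
Variable R : realType.
Implicit Types (z w l : R[i]) (u v : nat -> R[i]).

Lemma normcN z : normc (- z) = normc z.
Proof. by apply: (@complexI R); rewrite -!normr_normc normrN. Qed.

Lemma normc_distC z w : normc (z - w) = normc (w - z).
Proof. by rewrite -normcN opprB. Qed.

Lemma normcX z n : normc (z ^+ n) = normc z ^+ n.
Proof. by elim: n => [|n IH]; rewrite ?normc1// !exprS normcM IH. Qed.

Lemma normc_nat n : normc (n%:R : R[i]) = n%:R.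
Proof. by rewrite -(rmorph_nat (real_complex R)) normc_real ger0_norm. Qed.

Lemma normc_eq0 z : (normc z == 0) = (z == 0).
Proof. by apply/eqP/eqP => [/eq0_normc|->] //; rewrite normc0. Qed.

Lemma normc_gt0 z : (0 < normc z) = (z != 0).
Proof. by rewrite lt_neqAle normc_ge0 andbT eq_sym normc_eq0. Qed.

Lemma normc_sum (I : Type) (r : seq I) (P : pred I) (F : I -> R[i]) :
  normc (\sum_(i <- r | P i) F i) <= \sum_(i <- r | P i) normc (F i).
Proof.
elim/big_rec2: _ => [|i y x _ h]; first by rewrite normc0.
by rewrite (le_trans (normcD _ _))// lerD2l.
Qed.

Lemma normc_conj z : normc z^* = normc z.
Proof. by apply: (@complexI R); rewrite -!normr_normc norm_conjC. Qed.

Lemma lerB_normcB z w : normc z - normc w <= normc (z - w).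
Proof. by have := normcD (z - w) w; rewrite subrK lerBlDr. Qed.

Lemma cvgCP u l : u @ \oo --> l <->
  forall e : R, 0 < e -> \forall n \near \oo, normc (u n - l) < e.
Proof.
split=> [/cvgrPdist_lt h e e0|h].
  have := h e%:C%C; rewrite ltcR => /(_ e0); apply: filterS => n.
  by rewrite normc_lt normc_distC.
apply/cvgrPdist_lt => _ /gt0C[e e0 ->]; apply: filterS (h e e0) => n.
by rewrite normc_lt normc_distC.
Qed.

Lemma cvgC_normc_le u l (M : R) :
  (\forall n \near \oo, normc (u n) <= M) -> u @ \oo --> l -> normc l <= M.
Proof.
move=> uM /cvgCP ul; apply/ler_addgt0Pr => e e0.
near \oo => n.
have h1 : normc (u n) <= M by near: n.
have h2 : normc (u n - l) < e by near: n; exact: ul.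
have := lerB_normcB l (l - u n); rewrite subKr (normc_distC l) => h3.
by lra.
Unshelve. all: by end_near. Qed.

Lemma cvgC_unique u l l' : u @ \oo --> l -> u @ \oo --> l' -> l = l'.
Proof.
move=> ul ul'; apply/eqP; rewrite -subr_eq0 -normc_eq0 eq_le normc_ge0 andbT.
apply: (@cvgC_normc_le (fun n => u n - u n)); last exact: (cvgB ul ul').
by apply: nearW => n; rewrite subrr normc0.
Qed.

End modulus.

(** * Second divided differences of analytic functions *)

Section divided_differences.
Variable R : realType.
Implicit Types (z x y u : R[i]) (g : R[i] -> R[i]).

Lemma normc_subX x y (p : R) n : 0 < p -> normc x <= p -> normc y <= p ->
  normc (x ^+ n - y ^+ n) <= normc (x - y) * ((2 * p) ^+ n / p).
Proof.
move=> p0 xp yp; elim: n => [|n IH].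
  by rewrite subrr normc0 mulr_ge0 ?normc_ge0// divr_ge0 ?ltW ?expr0.
rewrite (_ : _ - _ = x * (x ^+ n - y ^+ n) + (x - y) * y ^+ n); last first.
  by rewrite !exprS; ring.
apply: (le_trans (normcD _ _)); rewrite !normcM normcX.
apply: (@le_trans _ _ (p * (normc (x - y) * ((2 * p) ^+ n / p)) +
    normc (x - y) * p ^+ n)).
  apply: lerD; first by apply: ler_pM => //; exact: normc_ge0.
  rewrite ler_wpM2l ?normc_ge0// lerXn2r ?nnegrE ?normc_ge0//.
  exact: ltW.
have h : p ^+ n <= (2 * p) ^+ n.
  by rewrite lerXn2r ?nnegrE ?mulr_ge0 ?ltW//; lra.
have := ler_wpM2l (normc_ge0 (x - y)) h.
rewrite exprS => {}h.
rewrite (_ : p * _ = normc (x - y) * (2 * p) ^+ n); last by field; lra.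
rewrite (_ : _ * (_ / p) = 2 * (normc (x - y) * (2 * p) ^+ n)); last by field; lra.
lra.
Qed.

(** The three differences come from the recursion [T n.+1 = z * T n + (x - z)
    * (y - z) * (x ^+ n - y ^+ n)] for the left-hand side [T n].  The factor
    [2 ^+ n] is affordable: coefficients of a power series are tested against
    [4^-1 ^+ n]. *)
Lemma normc_dd2X z x y (p : R) n : 0 < p ->
  normc z <= p -> normc x <= p -> normc y <= p ->
  normc ((y - z) * (x ^+ n - z ^+ n) - (x - z) * (y ^+ n - z ^+ n)) <=
  normc (x - z) * normc (y - z) * normc (x - y) * ((2 * p) ^+ n / p ^+ 2).
Proof.
move=> p0 zp xp yp; elim: n => [|n IH].
  rewrite !subrr !mulr0 subrr normc0 expr0 mul1r.
  by rewrite mulr_ge0 ?invr_ge0 ?exprn_ge0 ?(ltW p0)// !mulr_ge0 ?normc_ge0.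
move: IH; set T := (y - z) * _ - _; set W := _ * normc (x - y) => IH.
rewrite (_ : _ - _ = z * T + (x - z) * (y - z) * (x ^+ n - y ^+ n)); last first.
  by rewrite /T !exprS; ring.
apply: (le_trans (normcD _ _)); rewrite !normcM.
have h1 : normc z * normc T <= p * (W * ((2 * p) ^+ n / p ^+ 2)).
  by rewrite ler_pM ?normc_ge0.
have h2 : normc (x - z) * normc (y - z) * normc (x ^+ n - y ^+ n) <=
    W * ((2 * p) ^+ n / p).
  rewrite /W -[leRHS]mulrA ler_wpM2l ?mulr_ge0 ?normc_ge0//.
  exact: normc_subX.
rewrite (le_trans (lerD h1 h2))// le_eqVlt; apply/orP; left; apply/eqP.
by rewrite [(2 * p) ^+ n.+1]exprS; field; lra.
Qed.

(** The numerator of the divided difference of [g] at [z], [x], [y], so that no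
    distinctness of the points is required. *)
Definition dd2_bounded g z (K : R) x y :=
  normc ((y - z) * (g x - g z) - (x - z) * (g y - g z)) <=
  K * (normc (x - z) * normc (y - z) * normc (x - y)).

Lemma analytic_dd2_bounded g z0 : analytic_at g z0 ->
  exists2 d : R, 0 < d & exists K : R, forall z x y,
    normc (z - z0) < d -> normc (x - z0) < d -> normc (y - z0) < d ->
    dd2_bounded g z K x y.
Proof.
move=> [a ga]; have [M M0 /nearC[d1 d10 aM]] := analytic_bound ga.
move: ga => /nearC[d2 d20 ga].
pose p := Num.min d1 d2 / 2.
have m0 : 0 < Num.min d1 d2 by rewrite lt_min d10.
have p0 : 0 < p by rewrite divr_gt0.
have [pd1 pd2] : p < d1 /\ p < d2.
  by apply/andP; rewrite -lt_min /p ltr_pdivrMr// ltr_pMr ?ltr1n.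
clearbody p; have ap k : normc (a k) * p ^+ k <= M * 4^-1 ^+ k.
  have := aM (z0 + p%:C%C); rewrite (addrC z0) addrK normc_real gtr0_norm//.
  by move=> /(_ pd1 k); rewrite normcM normcX normc_real gtr0_norm.
exists p => //; exists (2 * M / p ^+ 2) => z x y zp xp yp; rewrite /dd2_bounded.
set W := _ * normc (x - y).
have W0 : 0 <= W by rewrite !mulr_ge0 ?normc_ge0.
pose S (t : R[i]) : nat -> R[i] := series (fun k => a k * (t - z0) ^+ k).
have cS t : normc (t - z0) < p -> S t @ \oo --> g t.
  by move=> h; apply: ga; exact: lt_trans pd2.
pose T n : R[i] := (y - z) * (S x n - S z n) - (x - z) * (S y n - S z n).
apply: (@cvgC_normc_le _ T); last first.
  have d t : normc (t - z0) < p -> (fun n => S t n - S z n) @ \oo --> g t - g z.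
    by move=> tp; exact: (cvgB (cS t tp) (cS z zp)).
  have m (c : R[i]) t : normc (t - z0) < p ->
      (fun n => c * (S t n - S z n)) @ \oo --> c * (g t - g z).
    by move=> tp; exact: (cvgM (cvg_cst c) (d t tp)).
  exact: (cvgB (m (y - z) x xp) (m (x - z) y yp)).
apply: nearW => n.
have TE : normc (T n) <= W * (M / p ^+ 2) * (2 - 2 * 2^-1 ^+ n).
  elim: n => [|n IH].
    rewrite /T /S /series /= !big_geq// !subrr !mulr0 subrr normc0 expr0.
    by rewrite mulr1 subrr mulr0.
  rewrite (_ : T n.+1 = T n + a n * ((y - z) * ((x - z0) ^+ n - (z - z0) ^+ n)
      - (x - z) * ((y - z0) ^+ n - (z - z0) ^+ n))); last first.
    by rewrite /T /S /series /= !big_nat_recr//=; ring.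
  apply: (le_trans (normcD _ _)); rewrite normcM.
  have := @normc_dd2X (z - z0) (x - z0) (y - z0) p n p0 (ltW zp) (ltW xp) (ltW yp).
  rewrite (_ : x - z0 - (z - z0) = x - z); last by ring.
  rewrite (_ : y - z0 - (z - z0) = y - z); last by ring.
  rewrite (_ : x - z0 - (y - z0) = x - y); last by ring.
  rewrite -/W => h.
  have h1 := ler_wpM2l (normc_ge0 (a n)) h.
  have h2 : normc (a n) * (W * ((2 * p) ^+ n / p ^+ 2)) <=
      W * (M / p ^+ 2) * 2^-1 ^+ n.
    rewrite (_ : _ * _ = (normc (a n) * p ^+ n) * (W * (2 ^+ n / p ^+ 2))); last first.
      by rewrite [(2 * p) ^+ n]exprMn; ring. 
    rewrite (_ : _ * 2^-1 ^+ n = (M * 4^-1 ^+ n) * (W * (2 ^+ n / p ^+ 2))); last first.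
      rewrite !exprVn (_ : 4 = 2 * 2 :> R); last by ring.
      by rewrite [(2 * 2) ^+ n]exprMn; field; rewrite expf_neq0 ?gt_eqF.
    by rewrite ler_wpM2r// mulr_ge0// divr_ge0 ?exprn_ge0// ltW.
  apply: (le_trans (lerD IH (le_trans h1 h2))).
  by rewrite [2^-1 ^+ n.+1]exprS le_eqVlt; apply/orP; left; apply/eqP; field; lra.
apply: (le_trans TE).
rewrite (_ : 2 * M / p ^+ 2 * W = W * (M / p ^+ 2) * 2); last by ring.
apply: ler_wpM2l.
  by rewrite mulr_ge0// divr_ge0// exprn_ge0// ltW.
by rewrite gerBl mulr_ge0 ?exprn_ge0.
Qed.

(** Compactness of the closed disk makes the local bounds uniform; [K] is taken
    to be the inverse of [d], which turns the pair of constants into a single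
    parameter to be chosen small. *)
Lemma cdisk_dd2_bounded g (r r1 : R) : r < r1 -> analytic_on (disk r1) g ->
  exists2 d : R, 0 < d & exists2 K : R, 0 <= K & forall z x y, normc z <= r ->
    normc (x - z) <= d -> normc (y - z) <= d -> dd2_bounded g z K x y.
Proof.
move=> rr1 ag.
have /compact_near_coveringP cov := @cdisk_compact R r.
have : \forall e \near (0 : R)^'+, cdisk r `<=` [set z | forall x y,
    normc (x - z) <= e -> normc (y - z) <= e -> dd2_bounded g z e^-1 x y].
  apply: cov => z0 /= z0r.
  have /analytic_dd2_bounded[d d0 [K gK]] := ag z0 (le_lt_trans z0r rr1).
  have d20 : 0 < d / 2 by rewrite divr_gt0.
  have K0 : 0 < `|K| + 1 by rewrite ltr_wpDl.
  near=> z e => /= x y xz yz.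
  have zz0 : normc (z - z0) < d / 2 by near: z; apply/nearC; exists (d / 2).
  have e0 : 0 < e by near: e; exact: nbhs_right_gt.
  have ed : e < d / 2 by near: e; exact: nbhs_right_lt.
  have eK : e < (`|K| + 1)^-1 by near: e; apply: nbhs_right_lt; rewrite invr_gt0.
  have hx := normcD (x - z) (z - z0); have hy := normcD (y - z) (z - z0).
  rewrite !addrA !subrK in hx hy.
  have h : dd2_bounded g z K x y by apply: gK; lra.
  apply: (le_trans h); rewrite ler_wpM2r ?mulr_ge0 ?normc_ge0//.
  apply: (le_trans (ler_norm K)).
  have : `|K| + 1 <= e^-1 by rewrite -[leLHS]invrK lef_pV2 ?posrE ?invr_gt0// ltW.
  by lra.
move=> H; near (0 : R)^'+ => e.
have e0 : 0 < e by near: e; exact: nbhs_right_gt.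
exists e => //; exists e^-1; first by rewrite invr_ge0 ltW.
have eP : cdisk r `<=` [set z | forall x y,
    normc (x - z) <= e -> normc (y - z) <= e -> dd2_bounded g z e^-1 x y] by near: e.
by move=> z x y zr; exact: eP.
Unshelve. all: by end_near. Qed.

End divided_differences.

(** * Means over roots of unity *)

Section circle_means.
Variable R : realType.
Implicit Types (z x y u : R[i]) (g F : R[i] -> R[i]) (r s : R).

(** A primitive root of unity of order [N.+3]; the shift makes its argument less
    than [pi], so that its sine is positive. *)
Definition uroot N : R[i] :=
  (cos (2 * pi / N.+3%:R) +i* sin (2 * pi / N.+3%:R))%C.

Lemma cisD (a b : R) : (cos (a + b) +i* sin (a + b))%C =
  ((cos a +i* sin a) * (cos b +i* sin b))%C.
Proof. by rewrite cosD sinD; simpc; congr (_ +i* _)%C; rewrite addrC. Qed.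

Lemma urootX N k : uroot N ^+ k =
  (cos (k%:R * (2 * pi / N.+3%:R)) +i* sin (k%:R * (2 * pi / N.+3%:R)))%C.
Proof.
elim: k => [|k IH]; first by rewrite expr0 mul0r cos0 sin0.
rewrite exprS IH -cisD.
rewrite (_ : k.+1%:R * _ = 2 * pi / N.+3%:R + k%:R * (2 * pi / N.+3%:R))//.
by rewrite -natr1 mulrDl mul1r addrC.
Qed.

Lemma urootN N : uroot N ^+ N.+3 = 1.
Proof.
rewrite urootX mulrC divfK ?pnatr_eq0//.
by rewrite mulr_natl cos2pi sin2pi.
Qed.

Lemma normc_uroot N k : normc (uroot N ^+ k) = 1.
Proof.
by rewrite urootX /normc cos2Dsin2 sqrtr1.
Qed.

Lemma uroot_neq0 N k : uroot N ^+ k != 0.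
Proof. by rewrite -normc_gt0 normc_uroot. Qed.

Lemma uroot_neq1 N : uroot N != 1.
Proof.
rewrite eq_complex /= negb_and; apply/orP; right; rewrite gt_eqF// sin_gt0_pi//.
rewrite divr_gt0 ?mulr_gt0 ?pi_gt0//=.
by rewrite ltr_pdivrMr// mulrC ltr_pM2l ?pi_gt0// ltr_nat.
Qed.

Lemma uroot_cvg : uroot @ \oo --> (1 : R[i]).
Proof.
have t0 : (fun N => 2 * pi / N.+3%:R) @ \oo --> (0 : R).
  rewrite -(mulr0 (2 * pi : R)); apply: cvgM; first exact: cvg_cst.
  have := @cvg_harmonic R; rewrite -(cvg_shiftn 2).
  apply: cvg_trans; apply: near_eq_cvg; apply: nearW => n /=.
  by rewrite addn2.
have c1 : (fun N => cos (2 * pi / N.+3%:R)) @ \oo --> (1 : R).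
  by rewrite -[X in _ --> X]cos0; apply: continuous_cvg; [exact: continuous_cos|exact: t0].
have s1 : (fun N => sin (2 * pi / N.+3%:R)) @ \oo --> (0 : R).
  by rewrite -[X in _ --> X]sin0; apply: continuous_cvg; [exact: continuous_sin|exact: t0].
apply/cvgCP => e e0.
have e20 : 0 < e / 2 by rewrite divr_gt0.
near=> N.
have h1 : `|1 - cos (2 * pi / N.+3%:R)| < e / 2.
  by near: N; move/cvgrPdist_lt : c1; apply.
have h2 : `|0 - sin (2 * pi / N.+3%:R)| < e / 2.
  by near: N; move/cvgrPdist_lt : s1; apply.
rewrite (_ : uroot N - 1 = (cos (2 * pi / N.+3%:R) - 1)%:C%C
    + 'i%C * (sin (2 * pi / N.+3%:R))%:C%C); last first.
  by apply/eqP; rewrite eq_complex /=; apply/andP; split; apply/eqP; ring.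
apply: (le_lt_trans (normcD _ _)); rewrite normcM !normc_real.
have -> : normc ('i%C : R[i]) = 1.
  by rewrite /normc /= expr0n expr1n /= add0r sqrtr1.
by rewrite mul1r (splitr e) ltrD// ?(distrC (cos _))// -normrN -sub0r.
Unshelve. all: by end_near. Qed.

Definition cmean N r g : R[i] :=
  N.+3%:R^-1 * \sum_(k < N.+3) g (r%:C%C * uroot N ^+ k).

Lemma cmeanD N r g F : cmean N r (fun x => g x + F x) = cmean N r g + cmean N r F.
Proof. by rewrite /cmean big_split /= mulrDr. Qed.

Lemma cmeanZ N r c g : cmean N r (fun x => c * g x) = c * cmean N r g.
Proof. by rewrite /cmean -mulr_sumr mulrCA. Qed.

Lemma normc_circle N r k : 0 <= r -> normc (r%:C%C * uroot N ^+ k) = r.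
Proof. by move=> r0; rewrite normcM normc_real normc_uroot mulr1 ger0_norm. Qed.

Lemma eq_cmean N r g F : 0 <= r -> (forall x, normc x = r -> g x = F x) ->
  cmean N r g = cmean N r F.
Proof.
move=> r0 gF; rewrite /cmean; congr (_ * _); apply: eq_bigr => k _.
by rewrite gF// normc_circle.
Qed.

Lemma normc_cmean_le N r g M : 0 <= r -> (forall x, normc x = r -> normc (g x) <= M) ->
  normc (cmean N r g) <= M.
Proof.
move=> r0 gM; rewrite /cmean normcM normcV normc_nat ler_pdivrMl//.
apply: (le_trans (normc_sum _ _ _)).
rewrite -[N.+3 in leRHS]card_ord -sumr_const mulr_suml.
by apply: ler_sum => k _; rewrite mul1r gM// normc_circle.
Qed.

Lemma sum_uroot_shift N (F : R[i] -> R[i]) :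
  \sum_(k < N.+3) F (uroot N ^+ k.+1) = \sum_(k < N.+3) F (uroot N ^+ k).
Proof.
rewrite [LHS]big_ord_recr [RHS]big_ord_recl /= urootN expr0 addrC.
by congr (_ + _); apply: eq_bigr => k _.
Qed.

(** Inversion permutes the roots of unity. *)
Lemma sum_urootV N (F : R[i] -> R[i]) :
  \sum_(k < N.+3) F (uroot N ^+ k)^-1 = \sum_(k < N.+3) F (uroot N ^+ k).
Proof.
rewrite -[RHS]sum_uroot_shift (reindex_inj rev_ord_inj) /=.
apply: eq_bigr => k _; congr F.
apply: (mulIf (uroot_neq0 N (N.+3 - k.+1))); rewrite mulVf ?uroot_neq0//.
by rewrite -exprD addnC subnK ?urootN.
Qed.

(** Inversion exchanges the circles of radius [r] and [r^-1]: exterior functions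
    reduce to interior ones. *)
Lemma cmean_inv N r g : cmean N r (fun x => g x^-1) = cmean N r^-1 g.
Proof.
rewrite /cmean; congr (_ * _).
rewrite -[RHS](sum_urootV N (fun x => g (r^-1%:C%C * x))).
by apply: eq_bigr => k _; rewrite invfM fmorphV.
Qed.

End circle_means.

(** * The mean value property *)

Section mean_value.
Variable R : realType.
Implicit Types (z x y u : R[i]) (g F : R[i] -> R[i]) (r s : R).

Lemma cmean0 N g : cmean N 0 g = g 0.
Proof.
rewrite /cmean (eq_bigr (fun=> g 0)) => [|k _]; last by rewrite mul0r.
by rewrite sumr_const card_ord -[g 0 *+ _]mulr_natl mulKf// pnatr_eq0.
Qed.

(** The point of the outer circle is the base of the divided difference, its
    neighbours being the next root of unity and the inner point on the same ray.
    With this choice the inner radius may be zero. *)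
Lemma cmean_radial_step g r (d K rho rho' : R) N : 0 <= K ->
  (forall z x y, normc z <= r -> normc (x - z) <= d -> normc (y - z) <= d ->
     dd2_bounded g z K x y) ->
  0 <= rho -> rho < rho' -> rho' <= r -> rho' - rho <= d ->
  r * normc (uroot R N - 1) <= d ->
  normc (cmean N rho g - cmean N rho' g) <=
  K * (rho' - rho) * (r * normc (uroot R N - 1) + (rho' - rho)).
Proof.
move=> K0 gK rho0 lt_rho rho'r rhod rd.
have rho'0 : 0 < rho' by lra.
set w := uroot R N in rd *; set t := rho' - rho.
pose c := rho'%:C%C * (w - 1).
have c0 : 0 < normc c.
  rewrite normc_gt0 mulf_neq0//; first by rewrite (inj_eq (@complexI R)) gt_eqF.
  by rewrite subr_eq0 uroot_neq1.
have cr : normc c <= r * normc (w - 1).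
  by rewrite normcM normc_real gtr0_norm// ler_wpM2r ?normc_ge0.
pose D k := g (rho%:C%C * w ^+ k) - g (rho'%:C%C * w ^+ k).
pose E k := (rho - rho')%:C%C * (g (rho'%:C%C * w ^+ k.+1) - g (rho'%:C%C * w ^+ k))
  - c * D k.
have EK k : normc (E k) <= K * (normc c * t * (normc c + t)).
  set z := rho'%:C%C * w ^+ k; set x := rho'%:C%C * w ^+ k.+1.
  set y := rho%:C%C * w ^+ k.
  have xz : x - z = w ^+ k * c by rewrite /x /z /c exprS; ring.
  have yz : y - z = w ^+ k * (rho - rho')%:C%C by rewrite /y /z rmorphB /=; ring.
  have nxz : normc (x - z) = normc c by rewrite xz normcM normc_uroot mul1r.
  have nyz : normc (y - z) = t.
    by rewrite yz normcM normc_uroot mul1r normc_real ltr0_norm ?opprB// subr_lt0.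
  have xy : normc (x - y) <= normc c + t.
    rewrite -nxz -nyz (_ : x - y = (x - z) - (y - z)); last by ring.
    by rewrite (le_trans (normcD _ _))// normcN.
  have := gK z x y; rewrite /dd2_bounded nxz nyz xz yz.
  rewrite (_ : _ - w ^+ k * c * _ = w ^+ k * E k); last first.
    by rewrite /E /D -/x -/y -/z; ring.
  rewrite (normcM (w ^+ k)) normc_uroot mul1r => h.
  apply: (le_trans (h _ _ _)).
  - by rewrite /z normc_circle// ltW.
  - by lra.
  - by rewrite /t; lra.
  - by rewrite ler_wpM2l// ler_wpM2l// mulr_ge0 ?normc_ge0// /t; lra.
(* The differences along the circle telescope. *)
have sumE : \sum_(k < N.+3) E k = - (c * \sum_(k < N.+3) D k).
  rewrite sumrB -mulr_sumr -mulr_sumr sumrB.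
  rewrite (sum_uroot_shift N (fun v => g (rho'%:C%C * v))).
  by rewrite subrr mulr0 add0r.
have -> : cmean N rho g - cmean N rho' g = N.+3%:R^-1 * \sum_(k < N.+3) D k.
  by rewrite /cmean -mulrBr -sumrB.
rewrite normcM normcV normc_nat ler_pdivrMl// -(ler_pM2l c0) -normcM -normcN -sumE.
apply: (le_trans (normc_sum _ _ _)).
apply: (@le_trans _ _ (\sum_(k < N.+3) K * (normc c * t * (normc c + t)))).
  by apply: ler_sum => k _.
rewrite sumr_const card_ord -[leLHS]mulr_natl.
rewrite (_ : N.+3%:R * (K * (normc c * t * (normc c + t))) =
  normc c * (N.+3%:R * (K * t * (normc c + t)))); last by ring.
rewrite ler_pM2l// ler_pM2l ?ltr0n// ler_wpM2l ?lerD2r//.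
by rewrite mulr_ge0// /t; lra.
Qed.

(** The closed disk is cut into [L] rings.  A ring contributes an error of order
    [r / L] times [r * |w - 1| + r / L], where [w] is the root of unity in use;
    the sum over the rings is small once [L] is large and [w] is close to [1]. *)
Lemma cmean_cvg g r r1 : 0 <= r -> r < r1 -> analytic_on (disk r1) g ->
  (fun N => cmean N r g) @ \oo --> g 0.
Proof.
move=> r0 rr1 ag; have [d d0 [K K0 gK]] := cdisk_dd2_bounded rr1 ag.
have [->|r_neq0] := eqVneq r 0.
  by apply: cvg_near_cst; apply: nearW => N; rewrite cmean0.
have rgt0 : 0 < r by rewrite lt_def r_neq0.
apply/cvgCP => e e0.
pose t := Num.min (d / r) (e / 2 / (K * r ^+ 2 + 1)).
have Kr1 : 0 < K * r ^+ 2 + 1 by rewrite ltr_wpDl// mulr_ge0// exprn_ge0.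
have t0 : 0 < t by rewrite lt_min !divr_gt0.
pose L := (Num.truncn t^-1).+1.
have Lt : L%:R^-1 <= t.
  rewrite -[leRHS]invrK lef_pV2 ?posrE ?invr_gt0// ltW//.
  exact: truncnS_gt.
have rLd : r / L%:R <= d.
  have : L%:R^-1 <= d / r by rewrite (le_trans Lt)// ge_min lexx.
  by rewrite ler_pdivlMr// mulrC.
have KL : K * r * (r / L%:R) < e / 2.
  have h : L%:R^-1 <= e / 2 / (K * r ^+ 2 + 1) by rewrite (le_trans Lt)// ge_min lexx orbT.
  rewrite (_ : _ * _ = K * r ^+ 2 * L%:R^-1); last by ring.
  have L0 : 0 < L%:R^-1 :> R by rewrite invr_gt0.
  by move: h; rewrite ler_pdivlMr// mulrC; lra.
have w1 : (fun N => normc (uroot R N - 1)) @ \oo --> (0 : R).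
  apply/cvgrPdist_lt => e' e'0; move/cvgCP : (@uroot_cvg R) => /(_ _ e'0).
  by apply: filterS => N; rewrite sub0r normrN ger0_norm ?normc_ge0.
have K1 : 0 < e / 2 / (K * r ^+ 2 + 1) by rewrite !divr_gt0.
near=> N.
have rd : r * normc (uroot R N - 1) <= d.
  rewrite mulrC -ler_pdivlMr// ltW//; near: N.
  have dr : 0 < d / r by rewrite divr_gt0.
  move/cvgrPdist_lt : w1 => /(_ _ dr); apply: filterS => N.
  by rewrite sub0r normrN ger0_norm ?normc_ge0.
have Kd : K * r * (r * normc (uroot R N - 1)) < e / 2.
  have : normc (uroot R N - 1) < e / 2 / (K * r ^+ 2 + 1).
    near: N; move/cvgrPdist_lt : w1 => /(_ _ K1); apply: filterS => N.
    by rewrite sub0r normrN ger0_norm ?normc_ge0.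
  rewrite ltr_pdivlMr// mulrC => h.
  rewrite (_ : _ * _ = K * r ^+ 2 * normc (uroot R N - 1)); last by ring.
  by have := normc_ge0 (uroot R N - 1); lra.
set a := normc (uroot R N - 1) in rd Kd *.
have stepL i : (i <= L)%N ->
    normc (cmean N (i%:R * (r / L%:R)) g - g 0) <= i%:R * (K * (r / L%:R) * (r * a + r / L%:R)).
  elim: i => [|i IH] iL; first by rewrite !mul0r cmean0 subrr normc0.
  have rL0 : 0 < r / L%:R by rewrite divr_gt0.
  have E1 : i.+1%:R * (r / L%:R) - i%:R * (r / L%:R) = r / L%:R.
    by rewrite -natr1; ring.
  have := @cmean_radial_step g r d K (i%:R * (r / L%:R)) (i.+1%:R * (r / L%:R)) N K0 gK.
  rewrite E1 => /(_ _ _ _ rLd rd) h.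
  rewrite (_ : _ - g 0 = (cmean N (i%:R * (r / L%:R)) g - g 0) -
    (cmean N (i%:R * (r / L%:R)) g - cmean N (i.+1%:R * (r / L%:R)) g)); last by ring.
  apply: (le_trans (normcD _ _)); rewrite -[i.+1%:R in leRHS]natr1 [leRHS]mulrDl mul1r.
  apply: lerD; [exact: IH (ltnW iL)|rewrite normcN; apply: h].
  - by rewrite mulr_ge0// ltW.
  - by rewrite ltr_pM2r// ltr_nat.
  - by rewrite mulrCA ler_piMr// ler_pdivrMr// mul1r ler_nat.
have := stepL L (leqnn L).
have -> : L%:R * (r / L%:R) = r by rewrite mulrC divfK ?pnatr_eq0.
have -> : L%:R * (K * (r / L%:R) * (r * a + r / L%:R)) = K * r * (r * a) + K * r * (r / L%:R).
  by field; rewrite pnatr_eq0.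
by lra.
Unshelve. all: by end_near. Qed.

End mean_value.

(** * Cauchy formula and estimates *)

Section cauchy.
Variable R : realType.
Implicit Types (z x y u : R[i]) (g h F H : R[i] -> R[i]) (r s : R).

Lemma analytic_near g F z0 : (\forall x \near z0, g x = F x) ->
  analytic_at g z0 -> analytic_at F z0.
Proof.
by move=> gF [a ga]; exists a; apply: filterS2 gF ga => x ->.
Qed.

(** Around [z0], [x - z] is [(z0 - z) * (1 - c * (x - z0))] for a suitable [c],
    which reduces the claim to a geometric series. *)
Lemma analytic_inv_sub z z0 : z0 != z -> analytic_at (fun x => (x - z)^-1) z0.
Proof.
rewrite -subr_eq0 => z0z.
have [a /nearC[d d0 ha]] : analytic_at (fun u => (1 - - (z0 - z)^-1 * u)^-1) 0.
  by apply: analyticV; rewrite mulr0 subr0 oner_neq0.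
suff : analytic_at (fun x => (z0 - z)^-1 * (1 - - (z0 - z)^-1 * (x - z0))^-1) z0.
  apply: analytic_near; apply: (@nearW _ (nbhs z0)) => x; rewrite -invfM; congr (_^-1).
  by field.
apply: analyticZ; exists a; apply/nearC; exists d => // x xz0.
by have := ha (x - z0); rewrite subr0; apply.
Qed.

Lemma analyticX n z0 : analytic_at (fun x : R[i] => x ^+ n) z0.
Proof.
elim: n => [|n IH].
  by apply: analytic_near (analytic_cst 1 z0); apply: (@nearW _ (nbhs z0)) => x; rewrite expr0.
apply: analytic_near (analyticM (analytic_id z0) IH).
by apply: (@nearW _ (nbhs z0)) => x; rewrite exprS.
Qed.

(** At [z] itself the quotient is the power series with shifted coefficients. *)
Lemma analytic_factor (U : set R[i]) g z : analytic_on U g -> U z ->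
  exists2 G, analytic_on U G & forall x, g x = g z + (x - z) * G x.
Proof.
move=> ag Uz; have [a az] := ag z Uz; have /nearC[d d0 ad] := az.
have gz : g z = a 0%N.
  have gz : series (fun k => a k * (z - z) ^+ k) @ \oo --> g z.
    by apply: ad; rewrite subrr normc0.
  apply: (cvgC_unique gz); rewrite subrr.
  apply: cvg_near_cst; exists 1%N => // -[//|n] _ /=.
  rewrite /series /= big_nat_recl// expr0 mulr1 big1 ?addr0// => i _.
  by rewrite expr0n mulr0.
pose G x := if x == z then a 1%N else (g x - g z) / (x - z).
exists G; last first.
  move=> x; rewrite /G; case: eqVneq => [->|xz]; first by rewrite subrr mul0r addr0.
  by rewrite mulrC divfK ?subr_eq0// addrC subrK.
move=> z0 Uz0; have [->|z0z] := eqVneq z0 z; last first.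
  apply: (@analytic_near (fun x => (g x + (-1) * g z) * (x - z)^-1)).
    apply/nearC; exists (normc (z0 - z)); first by rewrite normc_gt0 subr_eq0.
    move=> x xz0; rewrite /G mulN1r; case: eqVneq => // xz.
    by move: xz0; rewrite xz normc_distC ltxx.
  apply: analyticM; last exact: analytic_inv_sub.
  by apply: analyticD (ag z0 Uz0) _; exact: analytic_cst.
exists (fun k => a k.+1); apply/nearC; exists d; [exact: d0|move=> x xd].
have SE n : series (fun k => a k * (x - z) ^+ k) n.+1 =
    a 0%N + (x - z) * series (fun k => a k.+1 * (x - z) ^+ k) n.
  rewrite /series /= big_nat_recl// expr0 mulr1; congr (_ + _).
  by rewrite mulr_sumr; apply: eq_bigr => i _; rewrite exprS; ring.
rewrite /G; case: eqVneq => [xz|xz].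
  apply: cvg_near_cst; exists 1%N => // -[//|n] _ /=.
  rewrite /series /= xz subrr big_nat_recl// expr0 mulr1 big1 ?addr0// => i _.
  by rewrite expr0n mulr0.
have xz0 : x - z != 0 by rewrite subr_eq0.
have -> : series (fun k => a k.+1 * (x - z) ^+ k) =
    fun n => (x - z)^-1 * (series (fun k => a k * (x - z) ^+ k) n.+1 - a 0%N).
  by apply/funext => n; rewrite SE [X in _ = _ * X]addrAC subrr add0r mulKf.
have h1 : (fun n => series (fun k => a k * (x - z) ^+ k) n.+1) @ \oo --> g x.
  by have := ad x xd; rewrite -cvg_shiftS.
rewrite mulrC gz.
exact: (cvgM (cvg_cst (x - z)^-1) (cvgB h1 (cvg_cst (a 0%N)))).
Qed.

(** The mean value property at infinity, for functions analytic outside a disk. *)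
Lemma cmean_inv_cvg H r r1 : 0 < r -> r^-1 < r1 -> analytic_on (disk r1) H ->
  (fun N => cmean N r (fun x => H x^-1)) @ \oo --> H 0.
Proof.
move=> r0 rr1 aH; under eq_fun do rewrite cmean_inv.
by apply: (cmean_cvg _ rr1 aH); rewrite invr_ge0 ltW.
Qed.

Lemma one_sub_neq0 c z : normc c * normc z < 1 -> 1 - c * z != 0.
Proof.
move=> cz; apply/eqP => /eqP; rewrite subr_eq0 => /eqP e.
by move: cz; rewrite -normcM -e normc1 ltxx.
Qed.

Lemma analytic_disk_inv c r : normc c * r <= 1 ->
  analytic_on (disk r) (fun x => (1 - c * x)^-1).
Proof.
move=> cr z /= zr; apply: analyticV; have [->|c0] := eqVneq c 0.
  by rewrite mul0r subr0 oner_neq0.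
apply: one_sub_neq0; apply: lt_le_trans cr.
by rewrite ltr_pM2l// normc_gt0.
Qed.

Lemma circle_sub_neq0 x z r : normc x = r -> normc z < r -> x - z != 0.
Proof.
by move=> xr zr; rewrite subr_eq0; apply: contraTneq zr => <-; rewrite xr ltxx.
Qed.

(** Write [h x = h z + (x - z) * G x].  The mean of [x * G x] tends to its value
    [0] at the origin, and [x / (x - z)] is analytic outside the circle with value
    [1] at infinity. *)
Lemma cmean_cauchy h z r r1 : normc z < r -> r < r1 -> analytic_on (disk r1) h ->
  (fun N => cmean N r (fun x => x * h x / (x - z))) @ \oo --> h z.
Proof.
move=> zr rr1 ah; have r0 := le_lt_trans (normc_ge0 z) zr.
have [G aG hG] := analytic_factor ah (lt_trans zr rr1 : disk r1 z).
pose k x := (1 - z * x)^-1.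
have -> : (fun N => cmean N r (fun x => x * h x / (x - z))) =
    fun N => cmean N r (fun x => x * G x) + h z * cmean N r (fun x => k x^-1).
  apply/funext => N; rewrite -cmeanZ -cmeanD; apply: eq_cmean; first exact: ltW.
  move=> x xr; have xz := circle_sub_neq0 xr zr.
  have x0 : x != 0 by rewrite -normc_gt0 xr.
  by rewrite hG /k; field; rewrite x0 xz.
have h1 : (fun N => cmean N r (fun x => x * G x)) @ \oo --> (0 : R[i]).
  rewrite -[X in _ --> X](mul0r (G 0)).
  apply: (@cmean_cvg _ (fun x => x * G x)) rr1 _; first exact: ltW.
  by move=> x xr; apply: analyticM; [exact: analytic_id|exact: aG].
have k0 : k 0 = 1 by rewrite /k mulr0 subr0 invr1.
have h2 : (fun N => cmean N r (fun x => k x^-1)) @ \oo --> (1 : R[i]).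
  pose t := ((normc z + r) / 2)^-1.
  have zr0 : 0 < (normc z + r) / 2 by rewrite divr_gt0// ltr_wpDl// normc_ge0.
  rewrite -k0; apply: (@cmean_inv_cvg _ _ t r0).
    by rewrite ltf_pV2 ?posrE//; lra.
  apply: analytic_disk_inv; rewrite /t ler_pdivrMr// mul1r; lra.
rewrite -[X in _ --> X]add0r -[X in _ --> _ + X]mulr1.
exact: (cvgD h1 (cvgM (cvg_cst (h z)) h2)).
Qed.

(** A maximum principle up to a constant.  The constant depends only on [r] and
    on the modulus of [z], so limits are carried from the circle to [z]. *)
Lemma cauchy_bound h z r r1 M : normc z < r -> r < r1 -> analytic_on (disk r1) h ->
  (forall x, normc x = r -> normc (h x) <= M) ->
  normc (h z) <= M * r / (r - normc z).
Proof.
move=> zr rr1 ah hM; have r0 := le_lt_trans (normc_ge0 z) zr.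
apply: (cvgC_normc_le _ (cmean_cauchy zr rr1 ah)); apply: nearW => N.
apply: normc_cmean_le; first exact: ltW.
move=> x xr; rewrite !normcM normcV xr [r * _]mulrC.
have h1 : r - normc z <= normc (x - z) by rewrite -xr lerB_normcB.
have h2 : 0 < r - normc z by rewrite subr_gt0.
apply: ler_pM.
- by rewrite mulr_ge0 ?normc_ge0// ltW.
- by rewrite invr_ge0 normc_ge0.
- by rewrite ler_wpM2r ?hM// ltW.
- by rewrite lef_pV2 ?posrE// (lt_le_trans h2).
Qed.

(** The limit is the [j]-th Taylor coefficient.  Its independence of [r] is what
    links the values on the unit circle to the behaviour on larger circles. *)
Lemma cmean_taylor_cvg g r1 j : analytic_on (disk r1) g ->
  exists c : R[i], forall r, 0 < r -> r < r1 ->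
    (fun N => cmean N r (fun x => x^-1 ^+ j * g x)) @ \oo --> c.
Proof.
elim: j g => [|j IH] g ag.
  exists (g 0) => r r0 rr1.
  rewrite (_ : (fun x => _) = g); first exact: cmean_cvg (ltW r0) rr1 ag.
  by apply/funext => x; rewrite expr0 mul1r.
have [r10|r10] := leP r1 0.
  by exists 0 => r r0 rr1; have := lt_le_trans (lt_trans r0 rr1) r10; rewrite ltxx.
have d0 : disk r1 (0 : R[i]) by rewrite /disk /= normc0.
have [G aG gG] := analytic_factor ag d0.
have [c cG] := IH G aG; exists c => r r0 rr1.
have -> : (fun N => cmean N r (fun x => x^-1 ^+ j.+1 * g x)) =
    fun N => g 0 * cmean N r (fun x => x^-1 ^+ j.+1)
      + cmean N r (fun x => x^-1 ^+ j * G x).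
  apply/funext => N; rewrite -cmeanZ -cmeanD; apply: eq_cmean; first exact: ltW.
  move=> x xr; have x0 : x != 0 by rewrite -normc_gt0 xr.
  by rewrite gG subr0 exprS; field; rewrite x0.
have h1 : (fun N => cmean N r (fun x => x^-1 ^+ j.+1)) @ \oo --> (0 : R[i]).
  rewrite -[X in _ --> X](expr0n _ j.+1).
  apply: (@cmean_inv_cvg (fun x => x ^+ j.+1) r (r^-1 + 1)) => //.
    by rewrite ltrDl.
  by move=> x _; exact: analyticX.
rewrite -[X in _ --> X]add0r -[X in _ --> X + _](mulr0 (g 0)).
exact: (cvgD (cvgM (cvg_cst (g 0)) h1) (cG r r0 rr1)).
Qed.

End cauchy.

(** * Convergence in the space of germs *)

Section hol_facts.
Variable R : realType.
Implicit Types (f h y : hol R) (u : nat -> hol R).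

(** Translation invariance of the neighbourhoods reduces convergence to the basic
    neighbourhoods of zero. *)
Lemma hol_cvgP u y : u @ \oo --> y <->
  forall V, hol_nbhs0 V -> \forall n \near \oo, V (u n - y).
Proof.
split=> [uy V bV|uV A [V bV VA]].
  have : nbhs y [set h | V (h - y)].
    by exists V => // h Vh /=; rewrite addrAC subrr add0r.
  by move=> /uy.
have := uV V bV; apply: filterS => n /VA.
by rewrite addrC subrK.
Qed.

Lemma hol_nbhs0_unif e : 0 < e ->
  hol_nbhs0 [set f : hol R | forall z, normc (f z) <= e].
Proof.
move=> e0; split.
- by exists 0 => z /=; rewrite normc0 ltW.
- move=> x y a b xe ye ab z.
  apply: (@le_trans _ _ (normc a * e + normc b * e)).
    rewrite (le_trans (normcD _ _))// !normcM lerD// ler_wpM2l ?normc_ge0//.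
      exact: xe.
    exact: ye.
  by rewrite -mulrDl ler_piMl// ltW.
- move=> n n0; exists e => // g f _ ge fg z; rewrite fg ltW//.
  apply: (sup_norm_lt ge); rewrite /disk /=; apply: (le_lt_trans (valP z)).
  by rewrite /radius ltrDl invr_gt0 ltr0n.
Qed.

Lemma hol_cvg_unif u y e : 0 < e -> u @ \oo --> y ->
  \forall n \near \oo, forall z, normc (u n z - y z) <= e.
Proof. by move=> e0 /hol_cvgP/(_ _ (hol_nbhs0_unif e0)). Qed.

(** Uniform convergence on one larger disk suffices, because a basic neighbourhood
    of zero contains a ball of every step of the inductive limit. *)
Lemma hol_cvg_extension u y (w : nat -> R[i] -> R[i]) (r : R) m : (0 < m)%N ->
  radius R m < r -> (forall n, analytic_on (disk r) (w n)) ->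
  (forall n, extends (w n) (u n - y)) ->
  (forall e : R, 0 < e -> \forall n \near \oo,
     forall z, disk (radius R m) z -> normc (w n z) <= e) ->
  u @ \oo --> y.
Proof.
move=> m0 mr aw ew wc; apply/hol_cvgP => V [_ _ nV].
have [e e0 eV] := nV m m0; have e20 : 0 < e / 2 by rewrite divr_gt0.
have := wc _ e20; apply: filterS => n wn; apply: (eV (w n)); last exact: ew.
  split=> [z zr|]; first by apply: aw; apply: lt_trans mr.
  apply: continuous_in_subspaceT => z /set_mem zr.
  by apply: analytic_continuous; apply: aw; exact: le_lt_trans mr.
apply: (@le_lt_trans _ _ (e / 2)%:E); first exact: sup_normP.
by rewrite lte_fin ltr_pdivrMr// ltr_pMr// ltr1n.
Qed.

Lemma hol_seriesE (a : nat -> R[i]) (x : nat -> hol R) N z :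
  series (fun n => a n *: x n) N z = \sum_(k < N) a k * x k z.
Proof.
elim: N => [|N IH]; first by rewrite /series /= big_geq// big_ord0.
by rewrite /series /= big_nat_recr//= big_ord_recr /= -IH.
Qed.

End hol_facts.

(** * Blaschke factors *)

Section blaschke_factor.
Variable R : realType.
Implicit Types (l x z : R[i]) (rho r s : R).

Definition bfactor l x := (l - x) / (1 - l^* * x).

Lemma sqr_normc (a b : R) : normc (a +i* b)%C ^+ 2 = a ^+ 2 + b ^+ 2.
Proof. by rewrite /Normc.normc sqr_sqrtr// addr_ge0 ?sqr_ge0. Qed.

(** The identity behind all estimates of Blaschke factors: it compares numerator
    and denominator, and for [|l| < 1] the sign of the difference is that of
    [|x| - 1]. *)
Lemma normc_bfactor_num l x : normc (l - x) ^+ 2 =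
  normc (1 - l^* * x) ^+ 2 + (1 - normc l ^+ 2) * (normc x ^+ 2 - 1).
Proof.
case: l x => [a b] [c d].
have -> : 1 - (a +i* b)%C^* * (c +i* d)%C = ((1 - (a * c + b * d)) +i* (b * c - a * d))%C.
  by apply/eqP; rewrite eq_complex /=; apply/andP; split; apply/eqP; ring.
rewrite (_ : (a +i* b)%C - (c +i* d)%C = ((a - c) +i* (b - d))%C)//.
rewrite !sqr_normc; ring.
Qed.

Lemma bfactor_den_neq0 rho r l x : rho * r < 1 -> normc l <= rho -> normc x <= r ->
  1 - l^* * x != 0.
Proof.
move=> rr lr xr; apply: one_sub_neq0; rewrite normc_conj.
by apply: le_lt_trans rr; rewrite ler_pM ?normc_ge0.
Qed.

Lemma normc_bfactor_circle l x : normc l < 1 -> normc x = 1 -> normc (bfactor l x) = 1.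
Proof.
move=> l1 x1; have d0 : 1 - l^* * x != 0.
  by apply: (@bfactor_den_neq0 (normc l) 1); rewrite ?mulr1 ?x1.
have := normc_bfactor_num l x; rewrite x1 expr1n subrr mulr0 addr0 => /eqP.
rewrite eqrXn2 ?normc_ge0// => /eqP e.
by rewrite normcM normcV e divff// normc_eq0.
Qed.

Lemma normc_bfactor_ge rho r l x : rho < 1 -> 1 < r -> rho * r < 1 ->
  normc l <= rho -> normc x = r ->
  1 + (1 - rho ^+ 2) * (r ^+ 2 - 1) / (1 + r) ^+ 2 <= normc (bfactor l x) ^+ 2.
Proof.
move=> rho1 r1 rr lr xr; have rho0 := le_trans (normc_ge0 l) lr.
have d0 : 1 - l^* * x != 0 by apply: (bfactor_den_neq0 rr lr); rewrite xr.
have D0 : 0 < normc (1 - l^* * x) by rewrite normc_gt0.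
rewrite normcM normcV exprMn exprVn ler_pdivlMr ?exprn_gt0// (normc_bfactor_num l x) xr.
have D1 : normc (1 - l^* * x) <= 1 + r.
  rewrite (le_trans (normcD _ _))// normc1 normcN normcM normc_conj xr lerD2l.
  by rewrite ler_piMl ?(le_trans lr)// ltW// (lt_trans ltr01).
set D := normc (1 - _) in D0 D1 *.
rewrite mulrDl mul1r lerD2l.
have r20 : 0 < (1 + r) ^+ 2 by rewrite exprn_gt0//; lra.
rewrite mulrAC ler_pdivrMr//.
have l2 : normc l ^+ 2 <= rho ^+ 2 by rewrite lerXn2r ?nnegrE ?normc_ge0.
have rho2 : 0 <= 1 - rho ^+ 2 by rewrite subr_ge0 expr_le1// ltW.
have r2 : 0 <= r ^+ 2 - 1 by rewrite subr_ge0 expr_ge1//; lra.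
apply: ler_pM; [by rewrite mulr_ge0|by rewrite exprn_ge0// ltW| |].
  by rewrite ler_wpM2r//; lra.
by rewrite lerXn2r ?nnegrE// ltW//; lra.
Qed.

Lemma normc_bfactor_le rho r s l x : rho < 1 -> 1 <= s -> s <= r -> rho * r < 1 ->
  normc l <= rho -> normc x <= s ->
  normc (bfactor l x) ^+ 2 <= 1 + (s ^+ 2 - 1) / (1 - rho * r) ^+ 2.
Proof.
move=> rho1 s1 sr rr lr xs; have rho0 := le_trans (normc_ge0 l) lr.
have xr := le_trans xs sr.
have d0 : 1 - l^* * x != 0 by apply: (bfactor_den_neq0 rr lr).
have D0 : 0 < normc (1 - l^* * x) by rewrite normc_gt0.
rewrite normcM normcV exprMn exprVn ler_pdivrMr ?exprn_gt0// (normc_bfactor_num l x).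
have D1 : 1 - rho * r <= normc (1 - l^* * x).
  rewrite (le_trans _ (lerB_normcB _ _))// normc1 lerD2l lerN2 normcM normc_conj.
  by rewrite ler_pM ?normc_ge0.
set D := normc (1 - _) in D0 D1 *.
rewrite [leRHS]mulrDl mul1r lerD2l.
have r20 : 0 < (1 - rho * r) ^+ 2 by rewrite exprn_gt0//; lra.
have s2 : 0 <= s ^+ 2 - 1 by rewrite subr_ge0 expr_ge1//; lra.
rewrite mulrAC ler_pdivlMr//.
have l2 : 0 <= normc l ^+ 2 <= 1.
  by rewrite exprn_ge0 ?normc_ge0//= expr_le1 ?normc_ge0//; lra.
have x2 : normc x ^+ 2 <= s ^+ 2 by rewrite lerXn2r ?nnegrE ?normc_ge0//; lra.
apply: (@le_trans _ _ ((s ^+ 2 - 1) * (1 - rho * r) ^+ 2)).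
  rewrite ler_wpM2r ?(ltW r20)//; nra.
rewrite ler_wpM2l// lerXn2r ?nnegrE//; lra.
Qed.

Variable lam : nat -> R[i].

Lemma blaschke0 x : blaschke lam 0 x = 1.
Proof. by rewrite /blaschke big_geq. Qed.

Lemma blaschkeS n x : blaschke lam n.+1 x = blaschke lam n x * bfactor (lam n.+1) x.
Proof. by rewrite /blaschke big_nat_recr. Qed.

Lemma blaschke_shift n x :
  blaschke lam n.+1 x = bfactor (lam 1) x * blaschke (lam \o S) n x.
Proof. by rewrite /blaschke big_ltn// big_add1. Qed.

Lemma blaschke_analytic_disk rho r n : (forall k, (1 <= k)%N -> normc (lam k) <= rho) ->
  rho * r <= 1 -> 0 < r -> analytic_on (disk r) (blaschke lam n).
Proof.
move=> lr rr r0; elim: n => [|n IH] z zr.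
  by apply: analytic_near (analytic_cst 1 z); apply: (@nearW _ (nbhs z)) => x;
    rewrite blaschke0.
apply: (@analytic_near _ (fun x => blaschke lam n x *
    ((lam n.+1 + (-1) * x) * (1 - (lam n.+1)^* * x)^-1))).
  by apply: (@nearW _ (nbhs z)) => x; rewrite blaschkeS mulN1r.
apply: analyticM; first exact: IH.
apply: analyticM.
  apply: analyticD; first exact: analytic_cst.
  by apply: analyticZ; exact: analytic_id.
apply: (@analytic_disk_inv R (lam n.+1)^* r) => //.
by rewrite normc_conj (le_trans _ rr)// ler_wpM2r ?lr// ltW.
Qed.

End blaschke_factor.

(** * Interpolation at the zeros of the Blaschke products *)

Section expansion.
Variables (R : realType) (lam : nat -> R[i]) (rho r1 : R).
Hypothesis lam_le : forall k, (1 <= k)%N -> normc (lam k) <= rho.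
Hypothesis r1_gt1 : 1 < r1.
Hypothesis rho_r1 : rho * r1 < 1.
Implicit Types (x z : R[i]) (g F h : R[i] -> R[i]) (a : nat -> R[i]).

Let rho_ge0 : 0 <= rho.
Proof. exact: le_trans (normc_ge0 _) (lam_le (leqnn 1)). Qed.

Let rho_lt1 : rho < 1.
Proof. by move: rho_r1 r1_gt1 rho_ge0; nra. Qed.

Lemma blaschke_normc_ge kappa x n : 0 <= kappa ->
  (forall k, (1 <= k)%N -> kappa <= normc (bfactor (lam k) x)) ->
  kappa ^+ n <= normc (blaschke lam n x).
Proof.
move=> k0 hk; elim: n => [|n IH]; first by rewrite blaschke0 normc1.
by rewrite blaschkeS normcM exprSr ler_pM ?exprn_ge0 ?hk.
Qed.

Lemma blaschke_normc_le kappa x n :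
  (forall k, (1 <= k)%N -> normc (bfactor (lam k) x) <= kappa) ->
  normc (blaschke lam n x) <= kappa ^+ n.
Proof.
move=> hk; elim: n => [|n IH]; first by rewrite blaschke0 normc1.
by rewrite blaschkeS normcM exprSr ler_pM ?normc_ge0 ?hk.
Qed.

Lemma blaschke_den_neq0 k x : (1 <= k)%N -> disk r1 x -> 1 - (lam k)^* * x != 0.
Proof.
by move=> k1 xr; apply: (bfactor_den_neq0 rho_r1 (lam_le k1)); exact: ltW.
Qed.

(** Newton interpolation with Blaschke factors: subtract the value at the next
    zero, then divide by the corresponding factor. *)
Lemma blaschke_remainders g : analytic_on (disk r1) g ->
  exists F : nat -> R[i] -> R[i], F 0%N = g /\ forall n,
    analytic_on (disk r1) (F n) /\ forall x, disk r1 x ->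
      F n x = F n (lam n.+1) + bfactor (lam n.+1) x * F n.+1 x.
Proof.
move=> ag.
have step (p : nat * (R[i] -> R[i])) : exists G : R[i] -> R[i],
    analytic_on (disk r1) p.2 -> analytic_on (disk r1) G /\ forall x, disk r1 x ->
      p.2 x = p.2 (lam p.1.+1) + bfactor (lam p.1.+1) x * G x.
  case: p => n h /=.
  have [ah|nah] := pselect (analytic_on (disk r1) h); last by exists h.
  have lr : disk r1 (lam n.+1).
    by rewrite /disk /=; apply: le_lt_trans (lam_le (ltn0Sn n)) (lt_trans rho_lt1 r1_gt1).
  have [G aG hG] := analytic_factor ah lr.
  exists (fun x => (-1 + (lam n.+1)^* * x) * G x) => _; split.
    move=> x xr; apply: analyticM; last exact: aG.
    apply: analyticD; first exact: analytic_cst.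
    by apply: analyticZ; exact: analytic_id.
  move=> x xr; have d0 := blaschke_den_neq0 (ltn0Sn n) xr.
  by rewrite {1}hG /bfactor; field.
have [G hG] := choice step.
pose F := fix F n := if n is n'.+1 then G (n', F n') else g.
have aF n : analytic_on (disk r1) (F n).
  by elim: n => [//|n IH]; have [] := hG (n, F n) IH.
exists F; split=> [|n]; first by [].
split; first exact: aF.
by have [_] := hG (n, F n) (aF n); exact.
Qed.

Section remainders.
Variables (g : R[i] -> R[i]) (F : nat -> R[i] -> R[i]).
Hypothesis F0 : F 0%N = g.
Hypothesis aF : forall n, analytic_on (disk r1) (F n).
Hypothesis FS : forall n x, disk r1 x ->
  F n x = F n (lam n.+1) + bfactor (lam n.+1) x * F n.+1 x.

Lemma blaschke_expansion n x : disk r1 x ->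
  g x = \sum_(k < n) F k (lam k.+1) * blaschke lam k x + blaschke lam n x * F n x.
Proof.
move=> xr; elim: n => [|n IH].
  by rewrite big_ord0 add0r blaschke0 mul1r F0.
by rewrite IH big_ord_recr /= blaschkeS (FS n xr); ring.
Qed.

(** After the substitution [w = x^-1] the integrand becomes analytic in a disk of
    radius larger than [r^-1] and vanishes at [0]: the zeros of the denominators
    all lie inside the circle, and its numerator has smaller degree than its
    denominator.
    The proof adds one factor [(bfactor (lam k) x)^-1] at a time, starting from
    [i = 0], where the quotient of Blaschke products is a single inverse factor. *)
Lemma exterior_kernel_cvg r z n i : 1 < r -> r < r1 -> normc z < r -> (i <= n)%N ->
  (fun N => cmean N r (fun x => x * (blaschke lam (n - i) x / (blaschke lam n.+1 x *
     (1 - (lam n.+1)^* * x))) / (x - z))) @ \oo --> (0 : R[i]).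
Proof.
move=> r_gt1 rr1 zr ni; have r0 : 0 < r by lra.
(* The circle of radius [t] separates the given one from all the poles. *)
pose m := Num.max (normc z) 1.
have [zm m1 mr] : [/\ normc z <= m, 1 <= m & m < r].
  by rewrite /m; split; [rewrite le_max lexx|rewrite le_max lexx orbT|rewrite gt_max zr].
clearbody m; pose t := (m + r) / 2.
have t0 : 0 < t by rewrite /t; lra.
suff [H [aH H0 HE]] : exists H, [/\ analytic_on (disk t^-1) H, H 0 = 0 &
    forall x, normc x = r -> x * (blaschke lam (n - i) x / (blaschke lam n.+1 x *
     (1 - (lam n.+1)^* * x))) / (x - z) = H x^-1].
  rewrite -[X in _ --> X]H0.
  have -> : (fun N => cmean N r (fun x => x * (blaschke lam (n - i) x / (blaschke lam n.+1 x *
     (1 - (lam n.+1)^* * x))) / (x - z))) = fun N => cmean N r (fun x => H x^-1).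
    by apply/funext => N; apply: eq_cmean HE; exact: ltW.
  apply: (cmean_inv_cvg r0 _ aH).
  by rewrite ltf_pV2 ?posrE// /t; lra.
have ct c : normc c <= m -> normc c * t^-1 <= 1.
  by move=> cm; rewrite ler_pdivrMr// mul1r /t; lra.
have rm k : (1 <= k)%N -> normc (lam k) <= m.
  by move=> /lam_le; have := rho_lt1; lra.
have xl x k : (1 <= k)%N -> normc x = r -> lam k - x != 0.
  move=> k1 xr; rewrite subr_eq0; apply: contraTneq (rm k k1) => ->.
  by rewrite xr -ltNge.
have dk x k : (1 <= k)%N -> normc x = r -> 1 - (lam k)^* * x != 0.
  by move=> k1 xr; apply: blaschke_den_neq0 => //; rewrite /disk /= xr.
have b0 x k : normc x = r -> blaschke lam k x != 0.
  move=> xr; elim: k => [|k IH]; first by rewrite blaschke0 oner_neq0.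
  by rewrite blaschkeS /bfactor !mulf_neq0 ?invr_neq0 ?xl ?dk.
elim: i ni => [|i IH] ni.
  exists (fun w => (- w) * ((1 - lam n.+1 * w)^-1 * (1 - z * w)^-1)); split.
  - move=> w wt; apply: analyticM.
      apply: (@analytic_near _ (fun w => (-1) * w)).
        by apply: (@nearW _ (nbhs w)) => w'; rewrite mulN1r.
      by apply: analyticZ; exact: analytic_id.
    by apply: analyticM; (apply: (analytic_disk_inv _ wt); apply: ct => //; exact: rm).
  - by rewrite oppr0 mul0r.
  - move=> x xr; rewrite subn0 blaschkeS /bfactor.
    have x0 : x != 0 by rewrite -normc_gt0 xr.
    have xz := circle_sub_neq0 xr zr.
    have := xl x _ (ltn0Sn n) xr; have := dk x _ (ltn0Sn n) xr; have := b0 x n xr.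
    move: (_^*) => c h1 h2 h3.
    by field; rewrite h1 h2 h3 x0 xz -(opprB (lam n.+1)) oppr_eq0 h3.
have [H [aH H0 HE]] := IH (ltnW ni).
have k1 : (1 <= n - i)%N by rewrite subn_gt0.
have kE : (n - i = (n - i.+1).+1)%N by rewrite subnSK.
exists (fun w => H w * ((- w + (lam (n - i)%N)^*) * (1 - lam (n - i)%N * w)^-1)); split.
- move=> w wt; apply: analyticM; first exact: aH.
  apply: analyticM; last by apply: (analytic_disk_inv _ wt); apply: ct; exact: rm.
  apply: analyticD; last exact: analytic_cst.
  apply: (@analytic_near _ (fun w => (-1) * w)).
    by apply: (@nearW _ (nbhs w)) => w'; rewrite mulN1r.
  by apply: analyticZ; exact: analytic_id.
- by rewrite H0 mul0r.
- move=> x xr; have bE : blaschke lam (n - i) x =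
      blaschke lam (n - i.+1) x * bfactor (lam (n - i)%N) x by rewrite kE blaschkeS.
  rewrite -HE// bE /bfactor.
  have x0 : x != 0 by rewrite -normc_gt0 xr.
  have xz := circle_sub_neq0 xr zr.
  have := xl x _ k1 xr; have := dk x _ k1 xr; have := dk x _ (ltn0Sn n) xr.
  have h4 := b0 x n.+1 xr; move: ((lam n.+1)^*) ((lam (n - i)%N)^*) => c c' h1 h2 h3.
  by field; rewrite x0 xz h1 h2 h4 -(opprB (lam (n - i)%N)) oppr_eq0 h3.
Qed.

(** Inserting the expansion of [g] in the mean of [psi] leaves the Cauchy formula
    for [h], since the terms of the finite sum have means tending to zero.  Hence
    [h z] is bounded by the supremum of [psi], whose denominator contains
    [blaschke lam n.+1]. *)
Lemma blaschke_remainder_bound r s kappa M z n : 1 < r -> r < r1 -> normc z <= s -> s < r ->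
  0 < kappa ->
  (forall k x, (1 <= k)%N -> normc x = r -> kappa <= normc (bfactor (lam k) x)) ->
  (forall x, normc x = r -> normc (g x) <= M) ->
  normc (F n.+1 z) <= 2 * (r * M / ((1 - rho * r) * (r - s))) / kappa ^+ n.+1.
Proof.
move=> r_gt1 rr1 zs sr k0 hk gM.
have zr : normc z < r by exact: le_lt_trans zs sr.
have r0 : 0 < r by lra.
set l := lam n.+1.
have lrho : normc l <= rho by exact: lam_le.
have zr1 : disk r1 z by exact: lt_trans rr1.
have rhor : rho * r < 1 by move: rho_ge0 rho_r1; nra.
pose h x := F n.+1 x * (1 - l^* * x)^-1.
have ah : analytic_on (disk r1) h.
  move=> x xr; apply: analyticM; first exact: aF.
  apply: (analytic_disk_inv _ xr); rewrite normc_conj.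
  by move: lrho (normc_ge0 l) rho_r1 r1_gt1; nra.
pose phi (k : nat) x := x * (blaschke lam k x / (blaschke lam n.+1 x * (1 - l^* * x))) / (x - z).
have phi0 k : (k <= n)%N -> (fun N => cmean N r (phi k)) @ \oo --> (0 : R[i]).
  move=> kn; rewrite /phi -(subKn kn); apply: exterior_kernel_cvg => //.
  exact: leq_subr.
have S0 m : (m <= n.+1)%N -> (fun N => cmean N r (fun x =>
    \sum_(k < m) F k (lam k.+1) * phi k x)) @ \oo --> (0 : R[i]).
  elim: m => [|m IH] mn.
    apply: cvg_near_cst; apply: nearW => N; rewrite /cmean big1 ?mulr0// => k _.
    by rewrite big_ord0.
  have -> : (fun N => cmean N r (fun x => \sum_(k < m.+1) F k (lam k.+1) * phi k x)) =
      fun N => cmean N r (fun x => \sum_(k < m) F k (lam k.+1) * phi k x) +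
        F m (lam m.+1) * cmean N r (phi m).
    apply/funext => N; rewrite -cmeanZ -cmeanD; congr cmean; apply/funext => x.
    by rewrite big_ord_recr.
  rewrite -[X in _ --> X]addr0 -[X in _ --> _ + X](mulr0 (F m (lam m.+1))).
  exact: (cvgD (IH (ltnW mn)) (cvgM (cvg_cst _) (phi0 m mn))).
pose psi x := x * (g x / (blaschke lam n.+1 x * (1 - l^* * x))) / (x - z).
have bk x : normc x = r -> kappa ^+ n.+1 <= normc (blaschke lam n.+1 x).
  by move=> xr; apply: blaschke_normc_ge => [|k k1]; [exact: ltW|exact: hk].
have dx x : normc x = r -> 1 - rho * r <= normc (1 - l^* * x).
  move=> xr; rewrite (le_trans _ (lerB_normcB _ _))// normc1 lerD2l lerN2 normcM.
  by rewrite normc_conj xr ler_wpM2r// ltW.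
have psiE N : cmean N r psi = cmean N r (fun x => \sum_(k < n.+1) F k (lam k.+1) * phi k x)
    + cmean N r (fun x => x * h x / (x - z)).
  rewrite -cmeanD; apply: eq_cmean; first exact: ltW.
  move=> x xr; have xr1 : disk r1 x by rewrite /disk /= xr.
  rewrite /psi (blaschke_expansion n.+1 xr1) /h.
  have b0 : blaschke lam n.+1 x != 0.
    by rewrite -normc_gt0 (lt_le_trans _ (bk x xr))// exprn_gt0.
  have xz := circle_sub_neq0 xr zr; have d0 := blaschke_den_neq0 (ltn0Sn n) xr1.
  rewrite mulrDl mulrDr mulrDl; congr (_ + _); last first.
    by rewrite /l; move: (_^*) d0 => c d0; field; rewrite b0 xz d0.
  rewrite !(mulr_suml, mulr_sumr); apply: eq_bigr => k _.
  by rewrite /phi /l; move: (_^*) d0 => c d0; field; rewrite b0 xz d0.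
have psi_cvg : (fun N => cmean N r psi) @ \oo --> h z.
  have -> : (fun N => cmean N r psi) = fun N =>
      cmean N r (fun x => \sum_(k < n.+1) F k (lam k.+1) * phi k x)
    + cmean N r (fun x => x * h x / (x - z)) by apply/funext => N; rewrite psiE.
  rewrite -[X in _ --> X]add0r.
  exact: (cvgD (S0 n.+1 (leqnn _)) (cmean_cauchy zr rr1 ah)).
have M0 : 0 <= M.
  have := gM r%:C%C; rewrite normc_real gtr0_norm// => /(_ erefl).
  exact: le_trans (normc_ge0 _).
have hz : normc (h z) <= r * M / ((1 - rho * r) * (r - s)) / kappa ^+ n.+1.
  apply: (cvgC_normc_le _ psi_cvg); apply: nearW => N.
  apply: normc_cmean_le; first exact: ltW.
  move=> x xr; rewrite /psi !(normcM, normcV) xr.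
  have k1 : 0 < kappa ^+ n.+1 by rewrite exprn_gt0.
  have e1 : 0 < 1 - rho * r by lra.
  have e2 : 0 < r - s by lra.
  have i1 : (normc (blaschke lam n.+1 x))^-1 <= (kappa ^+ n.+1)^-1.
    by rewrite lef_pV2 ?posrE ?(lt_le_trans k1) ?bk.
  have i2 : (normc (1 - l^* * x))^-1 <= (1 - rho * r)^-1.
    by rewrite lef_pV2 ?posrE ?(lt_le_trans e1) ?dx.
  have xz : r - s <= normc (x - z).
    by rewrite (le_trans _ (lerB_normcB _ _))// xr lerD2l lerN2.
  have i3 : (normc (x - z))^-1 <= (r - s)^-1.
    by rewrite lef_pV2 ?posrE ?(lt_le_trans e2).
  rewrite (_ : r * M / _ / _ = r * (M * ((kappa ^+ n.+1)^-1 * (1 - rho * r)^-1)) * (r - s)^-1);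
    last by field; rewrite !gt_eqF.
  have n0 u : 0 <= (normc (u : R[i]))^-1 by rewrite invr_ge0 normc_ge0.
  rewrite invfM ler_pM ?mulr_ge0 ?normc_ge0 ?n0 ?(ltW r0)//.
  rewrite ler_wpM2l ?(ltW r0)// ler_pM ?mulr_ge0 ?normc_ge0 ?n0 ?gM//.
  by rewrite ler_pM ?n0.
have d0 := blaschke_den_neq0 (ltn0Sn n) zr1.
rewrite (_ : F n.+1 z = (1 - l^* * z) * h z); last by rewrite /h mulrC divfK.
rewrite normcM -[leRHS]mulrA ler_pM ?normc_ge0//.
rewrite (le_trans (normcD _ _))// normc1 normcN normcM normc_conj.
have : normc l * normc z <= rho * r by rewrite ler_pM ?normc_ge0// ltW.
lra.
Qed.

End remainders.
End expansion.

(** * Expansions when the zeros stay away from the circle *)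

Section uniformly_inside.
Variable R : realType.
Implicit Types (lam d a : nat -> R[i]) (x z : R[i]) (rho r : R).

Lemma analytic_on_sum (U : set R[i]) (a : nat -> R[i]) (h : nat -> R[i] -> R[i]) n :
  (forall k, analytic_on U (h k)) -> analytic_on U (fun x => \sum_(k < n) a k * h k x).
Proof.
move=> ah; elim: n => [|n IH] z Uz.
  apply: analytic_near (analytic_cst 0 z).
  by apply: (@nearW _ (nbhs z)) => x; rewrite big_ord0.
apply: (@analytic_near _ (fun x => \sum_(k < n) a k * h k x + a n * h n x)).
  by apply: (@nearW _ (nbhs z)) => x; rewrite big_ord_recr.
by apply: analyticD; [exact: IH|apply: analyticZ; exact: ah].
Qed.

(** At [lam 1] only the term of index [0] survives, and [cauchy_bound] carries the
    smallness from the circle to that point. *)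
Lemma blaschke_sum_coef0 lam d rho : rho < 1 ->
  (forall k, (1 <= k)%N -> normc (lam k) <= rho) ->
  (forall e : R, 0 < e -> \forall N \near \oo, forall x, normc x = 1 ->
     normc (\sum_(k < N) d k * blaschke lam k x) <= e) ->
  d 0%N = 0.
Proof.
move=> rho1 lr small.
  have rho0 : 0 <= rho by exact: le_trans (normc_ge0 _) (lr 1%N (leqnn _)).
  have l1 : normc (lam 1%N) < 1 by exact: le_lt_trans (lr 1%N _) rho1.
  have [r1 r1_gt1 rr1] : exists2 r1 : R, 1 < r1 & rho * r1 <= 1.
    by exists (1 + (1 - rho)); [lra|nra].
  apply/eqP; rewrite -normc_eq0 eq_le normc_ge0 andbT; apply/ler_addgt0Pr => e e0.
  rewrite add0r; have dl0 : 0 < 1 - normc (lam 1%N) by rewrite subr_gt0.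
  have ed0 : 0 < e * (1 - normc (lam 1%N)) by rewrite mulr_gt0.
  near \oo => N.
  have N1 : (1 <= N)%N by near: N; exact: nbhs_infty_ge.
  have sN x : normc x = 1 -> normc (\sum_(k < N) d k * blaschke lam k x) <=
      e * (1 - normc (lam 1%N)).
    by move: x; near: N; exact: small.
  have aS : analytic_on (disk r1) (fun x => \sum_(k < N) d k * blaschke lam k x).
    apply: analytic_on_sum => k; apply: blaschke_analytic_disk lr rr1 _.
    by rewrite (lt_trans ltr01).
  have := cauchy_bound l1 r1_gt1 aS sN.
  rewrite mulr1 mulfK ?gt_eqF//; congr (normc _ <= _).
  rewrite -(prednK N1) big_ord_recl /= blaschke0 mulr1 big1 ?addr0// => k _.
  by rewrite blaschke_shift /bfactor subrr !mul0r mulr0.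
Unshelve. all: by end_near. Qed.

(** Once the first coefficient is known to vanish, every remaining term contains
    the first factor, of modulus one on the circle: dividing by it leaves the same
    situation for the shifted sequences. *)
Lemma blaschke_sum_coef lam d rho : rho < 1 ->
  (forall k, (1 <= k)%N -> normc (lam k) <= rho) ->
  (forall e : R, 0 < e -> \forall N \near \oo, forall x, normc x = 1 ->
     normc (\sum_(k < N) d k * blaschke lam k x) <= e) ->
  forall n, d n = 0.
Proof.
move=> rho1 + + n; elim: n lam d => [|n IH] lam d lr small.
  exact: blaschke_sum_coef0 rho1 lr small.
have d0 := blaschke_sum_coef0 rho1 lr small.
apply: (IH (lam \o S) (d \o S)) => [k k1|e e0]; first exact: lr.
have [N0 _ small0] := small e e0.
exists N0 => // N /= N0N x x1.
have := small0 N.+1 (leq_trans N0N (leqnSn N)) x x1; congr (_ <= _).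
rewrite big_ord_recl /= d0 mul0r add0r.
under eq_bigr => k _ do rewrite /bump /= add1n blaschke_shift mulrCA.
rewrite -mulr_sumr normcM normc_bfactor_circle ?mul1r//.
exact: le_lt_trans (lr 1%N _) rho1.
Qed.

Variables (lam : nat -> R[i]) (rho : R).
Hypothesis hlam : forall n, (1 <= n)%N -> normc (lam n) < 1.
Hypothesis rho1 : rho < 1.
Hypothesis lr : forall k, (1 <= k)%N -> normc (lam k) <= rho.

Lemma blaschke_coef_unique (a b : nat -> R[i]) (y : hol R) :
  series (fun n => a n *: blaschke_hol hlam n) @ \oo --> y ->
  series (fun n => b n *: blaschke_hol hlam n) @ \oo --> y -> a = b.
Proof.
move=> ay byy; apply/funext => n; apply/eqP; rewrite -subr_eq0; apply/eqP.
apply: (@blaschke_sum_coef lam (fun n => a n - b n) rho rho1 lr) => e e0.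
have e20 : 0 < e / 2 by rewrite divr_gt0.
have := hol_cvg_unif e20 byy; apply: filterS2 (hol_cvg_unif e20 ay) => N aN bN x x1.
have xle : normc x <= 1 by rewrite x1.
pose z : closed_disk R := exist _ x xle.
rewrite (_ : \sum_(k < N) _ =
    (series (fun n => a n *: blaschke_hol hlam n) N z - y z) -
    (series (fun n => b n *: blaschke_hol hlam n) N z - y z)); last first.
  rewrite !hol_seriesE opprB addrA subrK -sumrB; apply: eq_bigr => k _.
  by rewrite mulrBl.
rewrite (le_trans (normcD _ _))// normcN (splitr e).
by rewrite lerD.
Qed.

Lemma exists_radius_le (t : R) : 0 < t -> exists2 m, (0 < m)%N & radius R m <= 1 + t.
Proof.
move=> t0; exists (Num.truncn t^-1).+1 => //; rewrite /radius lerD2l.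
by rewrite -[leRHS]invrK lef_pV2 ?posrE ?invr_gt0// ltW// truncnS_gt.
Qed.

(** The coefficients are the interpolation values [F k (lam k.+1)], and the error
    [blaschke lam N * F N] is geometrically small. *)
Lemma blaschke_series_cvg (f : hol R) : exists a : nat -> R[i],
  series (fun n => a n *: blaschke_hol hlam n) @ \oo --> f.
Proof.
have rho0 : 0 <= rho by exact: le_trans (normc_ge0 _) (lr (leqnn 1)).
have [n n0 [g [dg gf]]] := hol_step f.
have [M M0 gM] := disk_algebra_bounded dg; have [ag _] := dg.
pose r1 := Num.min (radius R n) (1 + (1 - rho) / 2).
have r1n : r1 <= radius R n by rewrite ge_min lexx.
have r1_gt1 : 1 < r1.
  by rewrite lt_min /radius !ltrDl invr_gt0 ltr0n n0 divr_gt0// subr_gt0.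
have rho_r1 : rho * r1 < 1.
  have : r1 <= 1 + (1 - rho) / 2 by rewrite ge_min lexx orbT.
  by nra.
have {}ag : analytic_on (disk r1) g.
  by move=> z zr; apply: ag; exact: lt_le_trans zr r1n.
clearbody r1.
have [F [F0 aF]] := blaschke_remainders lr r1_gt1 rho_r1 ag.
have aF1 k : analytic_on (disk r1) (F k) by have [] := aF k.
have FS k x : disk r1 x -> F k x = F k (lam k.+1) + bfactor (lam k.+1) x * F k.+1 x.
  by have [_] := aF k; exact.
pose r := (1 + r1) / 2.
have [r_gt1 rr1] : 1 < r /\ r < r1 by rewrite /r; split; lra.
have rho_r : rho * r < 1 by nra.
clearbody r.
(* [q] bounds the squared factors from below on the circle of radius [r]. *)
pose q := 1 + (1 - rho ^+ 2) * (r ^+ 2 - 1) / (1 + r) ^+ 2.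
have q1 : 1 < q.
  have h1 : 0 < 1 - rho ^+ 2 by nra.
  have h2 : 0 < r ^+ 2 - 1 by nra.
  have h3 : 0 < (1 + r) ^+ 2 by rewrite exprn_gt0//; lra.
  by rewrite /q ltrDl divr_gt0//; exact: mulr_gt0.
pose D := (1 - rho * r) ^+ 2.
have D0 : 0 < D by rewrite exprn_gt0//; lra.
(* The upper bound of the squared factors on a disk tends to [1] with its radius. *)
have [m m0 ms] : exists2 m, (0 < m)%N & radius R m < r /\ 1 + (radius R m ^+ 2 - 1) / D < q.
  pose t := Num.min 1 (Num.min ((r - 1) / 2) ((q - 1) * D / 6)).
  have t0 : 0 < t.
    by rewrite !lt_min ltr01 !divr_gt0 ?mulr_gt0 ?subr_gt0.
  have [m m0 mt] := exists_radius_le t0; exists m => //.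
  have : [/\ t <= 1, t <= (r - 1) / 2 & t <= (q - 1) * D / 6].
    by rewrite /t; split; rewrite !ge_min lexx ?orbT.
  clearbody t; move=> [t1 tr tq]; split; first by lra.
  rewrite -ltrBrDl ltr_pdivrMr//.
  have : 1 <= radius R m by rewrite /radius lerDl.
  by nra.
have [mr mq] := ms; set s := radius R m in mr mq.
have s1 : 1 <= s by rewrite /s /radius lerDl.
pose Q := 1 + (s ^+ 2 - 1) / D.
have Q1 : 1 <= Q by rewrite /Q lerDl divr_ge0 ?(ltW D0)//; nra.
pose kappa := Num.sqrt q; pose K := Num.sqrt Q.
have kappa0 : 0 < kappa by rewrite sqrtr_gt0; lra.
have K0 : 0 <= K by exact: sqrtr_ge0.
have Kk : K < kappa by rewrite ltr_sqrt//; lra.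
have hk k x : (1 <= k)%N -> normc x = r -> kappa <= normc (bfactor (lam k) x).
  move=> k1 xr; rewrite -(@ler_pXn2r _ 2) ?nnegrE ?normc_ge0 ?(ltW kappa0)//.
  by rewrite sqr_sqrtr; [exact: normc_bfactor_ge rho1 r_gt1 rho_r (lr k1) xr|lra].
have hK k x : (1 <= k)%N -> normc x <= s -> normc (bfactor (lam k) x) <= K.
  move=> k1 xs; rewrite -(@ler_pXn2r _ 2) ?nnegrE ?normc_ge0//.
  rewrite sqr_sqrtr; last lra.
  exact: (normc_bfactor_le rho1 s1 (ltW mr) rho_r (lr k1) xs).
have gMr x : normc x = r -> normc (g x) <= M.
  by move=> xr; apply: gM; rewrite /cdisk /= xr (le_trans (ltW rr1)).
pose C := 2 * (r * M / ((1 - rho * r) * (r - s))).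
have C0 : 0 < C by rewrite mulr_gt0// divr_gt0// mulr_gt0 ?subr_gt0// (lt_trans ltr01).
pose a k := F k (lam k.+1).
pose w N x := \sum_(k < N) a k * blaschke lam k x + (-1) * g x.
have wE N x : disk r1 x -> w N x = - (blaschke lam N x * F N x).
  move=> xr; rewrite /w (@blaschke_expansion _ _ _ g F F0 FS N x xr) mulN1r.
  by rewrite opprD addrA subrr add0r.
exists a; apply: (@hol_cvg_extension _ _ _ w r1 m m0).
- exact: lt_trans mr rr1.
- move=> N x xr; apply: analyticD; last by apply: analyticZ; exact: ag.
  apply: (@analytic_on_sum (disk r1) a (blaschke lam) N _ x xr) => k.
  exact: blaschke_analytic_disk lr (ltW rho_r1) (lt_trans ltr01 r1_gt1).
- by move=> N z; rewrite /w mulN1r -gf -(hol_seriesE a (blaschke_hol hlam)).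
move=> e e0.
have geo : (fun N => C * (K / kappa) ^+ N) @ \oo --> (0 : R).
  rewrite -(mulr0 C); apply: cvgM; first exact: cvg_cst.
  apply: cvg_expr; rewrite ger0_norm ?divr_ge0 ?(ltW kappa0)//.
  by rewrite ltr_pdivrMr// mul1r.
move/cvgrPdist_lt : geo => /(_ e e0) [N0 _ geo].
exists N0.+1 => // -[//|N] /= N0N x xs.
rewrite wE ?normcN; last by rewrite /disk /= (lt_trans xs)// (lt_trans mr).
rewrite normcM.
have := geo N.+1 (ltnW N0N); rewrite sub0r normrN => geoN.
have h1 := @blaschke_remainder_bound _ _ _ _ lr r1_gt1 rho_r1 g F F0 aF1 FS r s kappa M x N
  r_gt1 rr1 (ltW xs) mr kappa0 hk gMr.
have h2 := @blaschke_normc_le _ lam K x N.+1 (fun k k1 => hK k x k1 (ltW xs)).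
apply: (le_trans (ler_pM (normc_ge0 _) (normc_ge0 _) h2 h1)).
apply: ltW; apply: le_lt_trans geoN; apply: le_trans (ler_norm _).
rewrite -/C exprMn exprVn le_eqVlt; apply/orP; left; apply/eqP.
by ring.
Qed.

End uniformly_inside.

(** * Taylor coefficients *)

Section taylor.
Variable R : realType.
Implicit Types (x z mu c : R[i]) (g h : R[i] -> R[i]) (r : R) (f : hol R) (P Q : {poly R[i]}).

(** On the unit circle [x^-1 ^+ j] is the conjugate of [x ^+ j], so this is a
    Fourier coefficient; only the values of [g] on that circle enter. *)
Definition tcoef g j : R[i] :=
  xget 0 [set c | (fun N => cmean N 1 (fun x => x^-1 ^+ j * g x)) @ \oo --> c].

Definition analytic_beyond g := exists2 r1 : R, 1 < r1 & analytic_on (disk r1) g.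

Lemma tcoef_unique g j c :
  (fun N => cmean N 1 (fun x => x^-1 ^+ j * g x)) @ \oo --> c -> tcoef g j = c.
Proof.
move=> gc; apply: (cvgC_unique _ gc).
by apply: (@xgetPex _ 0 [set c | _ @ \oo --> c]); exists c.
Qed.

Lemma tcoef_cvg g j : analytic_beyond g ->
  (fun N => cmean N 1 (fun x => x^-1 ^+ j * g x)) @ \oo --> tcoef g j.
Proof.
move=> [r1 r1_gt1 ag]; have [c hc] := cmean_taylor_cvg j ag.
have cc := hc 1 ltr01 r1_gt1.
by rewrite (tcoef_unique cc).
Qed.

Lemma eq_tcoef g h j : (forall x, normc x = 1 -> g x = h x) -> tcoef g j = tcoef h j.
Proof.
move=> gh; rewrite /tcoef (_ : (fun N => cmean N 1 (fun x => x^-1 ^+ j * g x)) =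
  fun N => cmean N 1 (fun x => x^-1 ^+ j * h x))//.
by apply/funext => N; apply: eq_cmean => // x x1; rewrite gh.
Qed.

Lemma tcoefD g h j : analytic_beyond g -> analytic_beyond h ->
  tcoef (fun x => g x + h x) j = tcoef g j + tcoef h j.
Proof.
move=> ag ah; apply: tcoef_unique.
have -> : (fun N => cmean N 1 (fun x => x^-1 ^+ j * (g x + h x))) = fun N =>
    cmean N 1 (fun x => x^-1 ^+ j * g x) + cmean N 1 (fun x => x^-1 ^+ j * h x).
  apply/funext => N; rewrite -cmeanD; congr cmean; apply/funext => x.
  by rewrite mulrDr.
exact: (cvgD (tcoef_cvg ag) (tcoef_cvg ah)).
Qed.

Lemma tcoefZ c g j : analytic_beyond g -> tcoef (fun x => c * g x) j = c * tcoef g j.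
Proof.
move=> ag; apply: tcoef_unique.
have -> : (fun N => cmean N 1 (fun x => x^-1 ^+ j * (c * g x))) = fun N =>
    c * cmean N 1 (fun x => x^-1 ^+ j * g x).
  by apply/funext => N; rewrite -cmeanZ; congr cmean; apply/funext => x; ring.
exact: (cvgM (cvg_cst c) (tcoef_cvg ag)).
Qed.

Lemma tcoefXS g j : tcoef (fun x => x * g x) j.+1 = tcoef g j.
Proof.
rewrite /tcoef (_ : (fun N => cmean N 1 (fun x => x^-1 ^+ j.+1 * (x * g x))) =
  fun N => cmean N 1 (fun x => x^-1 ^+ j * g x))//.
apply/funext => N; apply: eq_cmean => // x x1.
have x0 : x != 0 by rewrite -normc_gt0 x1.
by rewrite exprSr -mulrA mulKf.
Qed.

Lemma tcoef0 g : analytic_beyond g -> tcoef g 0 = g 0.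
Proof.
move=> [r1 r1_gt1 ag]; apply: tcoef_unique.
have -> : (fun N => cmean N 1 (fun x => x^-1 ^+ 0 * g x)) = fun N => cmean N 1 g.
  by apply/funext => N; congr cmean; apply/funext => x; rewrite expr0 mul1r.
exact: (cmean_cvg ler01 r1_gt1 ag).
Qed.

Lemma analytic_beyondX g : analytic_beyond g -> analytic_beyond (fun x => x * g x).
Proof.
move=> [r1 r1_gt1 ag]; exists r1; first exact: r1_gt1.
by move=> z zr; apply: analyticM; [exact: analytic_id|exact: ag].
Qed.

Lemma analytic_beyondZ c g : analytic_beyond g -> analytic_beyond (fun x => c * g x).
Proof.
move=> [r1 r1_gt1 ag]; exists r1; first exact: r1_gt1.
by move=> z zr; apply: analyticZ; exact: ag.
Qed.

Lemma analytic_beyondD g h : analytic_beyond g -> analytic_beyond h ->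
  analytic_beyond (fun x => g x + h x).
Proof.
move=> [r1 r1_gt1 ag] [r2 r2_gt1 ah]; exists (Num.min r1 r2).
  by rewrite lt_min r1_gt1.
by move=> z; rewrite /disk /= lt_min => /andP[z1 z2]; apply: analyticD; [exact: ag|exact: ah].
Qed.

Lemma analytic_beyond_poly P : analytic_beyond (horner P).
Proof.
exists 2 => [|z _]; first by rewrite ltr1n.
elim/poly_ind: P => [|P c IH].
  by apply: analytic_near (analytic_cst 0 z); apply: (@nearW _ (nbhs z)) => x;
    rewrite horner0.
apply: (@analytic_near _ (fun x => P.[x] * x + c)).
  by apply: (@nearW _ (nbhs z)) => x; rewrite hornerMXaddC.
apply: analyticD (analytic_cst _ _); apply: analyticM; [exact: IH|exact: analytic_id].
Qed.

Lemma tcoef_cstS c j : tcoef (fun=> c) j.+1 = 0.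
Proof.
apply: tcoef_unique.
have h1 : (fun N => cmean N 1 (fun x : R[i] => x^-1 ^+ j.+1)) @ \oo --> (0 : R[i]).
  rewrite -[X in _ --> X](expr0n _ j.+1).
  apply: (@cmean_inv_cvg _ (fun x => x ^+ j.+1) 1 2) => //.
    by rewrite invr1 ltr1n.
  by move=> x _; exact: analyticX.
have -> : (fun N => cmean N 1 (fun x => x^-1 ^+ j.+1 * c)) =
    fun N => c * cmean N 1 (fun x : R[i] => x^-1 ^+ j.+1).
  by apply/funext => N; rewrite -cmeanZ; congr cmean; apply/funext => x; rewrite mulrC.
rewrite -[X in _ --> X](mulr0 c); exact: (cvgM (cvg_cst c) h1).
Qed.

Lemma tcoef_poly P j : tcoef (horner P) j = P`_j.
Proof.
elim/poly_ind: P j => [|P c IH] j.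
  rewrite coef0 (_ : horner 0 = fun x => 0 * horner (0 : {poly R[i]}) x).
    by rewrite tcoefZ ?mul0r//; exact: analytic_beyond_poly.
  by apply/funext => x; rewrite !horner0 mulr0.
have -> : horner (P * 'X + c%:P) = fun x => x * P.[x] + (horner c%:P) x.
  by apply/funext => x; rewrite hornerMXaddC hornerC mulrC.
rewrite tcoefD; [|exact/analytic_beyondX/analytic_beyond_poly|exact: analytic_beyond_poly].
rewrite coefD coefMX coefC; case: j => [|j] /=.
  rewrite !tcoef0 ?mul0r ?hornerC ?add0r//; first exact: analytic_beyond_poly.
  exact/analytic_beyondX/analytic_beyond_poly.
rewrite tcoefXS IH (@eq_tcoef _ (fun=> c)) ?tcoef_cstS// => x _.
by rewrite hornerC.
Qed.

(** Taylor coefficients are read off from the values on the unit circle. *)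
Lemma poly_circle_inj P Q : (forall x, normc x = 1 -> P.[x] = Q.[x]) -> P = Q.
Proof. by move=> PQ; apply/polyP => j; rewrite -!tcoef_poly; exact: eq_tcoef. Qed.

(** The mean may be taken over any circle in the domain of [g], not just the unit
    circle. *)
Lemma tcoef_cauchy g r r1 M j : 1 < r1 -> 0 < r -> r < r1 -> analytic_on (disk r1) g ->
  (forall x, normc x = r -> normc (g x) <= M) -> normc (tcoef g j) * r ^+ j <= M.
Proof.
move=> r1_gt1 r0 rr1 ag gM; have [c hc] := cmean_taylor_cvg j ag.
rewrite (tcoef_unique (hc 1 ltr01 r1_gt1)) -ler_pdivlMr ?exprn_gt0//.
apply: (cvgC_normc_le _ (hc r r0 rr1)); apply: nearW => N.
apply: normc_cmean_le => [|x xr]; first exact: ltW.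
rewrite normcM normcX normcV xr mulrC exprVn.
by rewrite ler_wpM2r ?gM// invr_ge0 exprn_ge0// ltW.
Qed.

Definition tcoef_bounded r g :=
  analytic_beyond g /\ exists M : R, forall j, normc (tcoef g j) * r ^+ j <= M.

Lemma tcoef_boundedM r g P : 0 <= r -> tcoef_bounded r g ->
  tcoef_bounded r (fun x => P.[x] * g x).
Proof.
move=> r0 bg; elim/poly_ind: P => [|P c [aP [M1 bP]]].
  have [ag [M bM]] := bg.
  rewrite (_ : (fun x => _) = fun x => 0 * g x).
    split; first exact: analytic_beyondZ.
    by exists 0 => j; rewrite tcoefZ// mul0r normc0 mul0r.
  by apply/funext => x; rewrite horner0.
have [ag [M2 bM]] := bg.
rewrite (_ : (fun x => _) = fun x => x * (P.[x] * g x) + c * g x); last first.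
  by apply/funext => x; rewrite hornerMXaddC; ring.
have aX := analytic_beyondX aP; have aZ := analytic_beyondZ c ag.
split; first exact: analytic_beyondD.
have M10 : 0 <= M1 by apply: le_trans (bP 0%N); rewrite mulr_ge0 ?normc_ge0 ?exprn_ge0.
exists (r * M1 + normc c * M2) => j.
rewrite tcoefD// tcoefZ//.
apply: (le_trans (ler_wpM2r (exprn_ge0 _ r0) (normcD _ _))).
rewrite mulrDl; apply: lerD; last first.
  by rewrite normcM -mulrA ler_wpM2l ?normc_ge0.
case: j => [|j].
  by rewrite tcoef0// mul0r normc0 mul0r mulr_ge0.
rewrite tcoefXS exprS mulrCA ler_wpM2l//; exact: bP.
Qed.

(** If [t] is the coefficient sequence of [g], then [P`_j = t j - mu * t j.-1]
    for positive [j] and [P`_0 = t 0], so the partial sums of [P.[mu^-1]] telescope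
    to [t J * mu^-1 ^+ J], which tends to zero when [t J * r ^+ J] is bounded. *)
Lemma tcoef_bounded_pole r mu g P : tcoef_bounded r g -> 1 < normc mu * r -> 0 < r ->
  (forall x, normc x = 1 -> (1 - mu * x) * g x = P.[x]) -> P.[mu^-1] = 0.
Proof.
move=> [ag [M gM]] mur r0 gP.
have mu0 : mu != 0.
  by apply/eqP => mu0; move: mur; rewrite mu0 normc0 mul0r ltNge ler01.
have nmu0 : 0 < normc mu by rewrite normc_gt0.
pose t := tcoef g.
have Pt j : P`_j = t j - mu * (if j is j'.+1 then t j' else 0).
  rewrite -tcoef_poly -(eq_tcoef j gP).
  rewrite (_ : (fun x => _) = fun x => g x + (- mu) * (x * g x)); last first.
    by apply/funext => x; ring.
  have aX := analytic_beyondX ag.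
  rewrite (tcoefD _ ag (analytic_beyondZ _ aX)) (tcoefZ _ _ aX) mulNr.
  case: j => [|j]; last by rewrite tcoefXS.
  by rewrite (tcoef0 aX) mul0r.
have sumE J : \sum_(j < J.+1) P`_j * mu^-1 ^+ j = t J * mu^-1 ^+ J.
  elim: J => [|J IH].
    by rewrite big_ord_recr big_ord0 /= add0r Pt mulr0 subr0.
  by rewrite big_ord_recr /= IH Pt exprS; field.
pose q := (normc mu * r)^-1.
have q1 : (fun J => M * q ^+ J) @ \oo --> (0 : R).
  rewrite -(mulr0 M); apply: cvgM; first exact: cvg_cst.
  apply: cvg_expr; rewrite ger0_norm ?invr_ge0 ?mulr_ge0 ?normc_ge0 ?(ltW r0)//.
  by rewrite invf_lt1// (lt_trans ltr01).
apply/eqP; rewrite -normc_eq0 eq_le normc_ge0 andbT; apply/ler_addgt0Pr => e e0.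
rewrite add0r; near \oo => J.
have JP : (size P <= J.+1)%N by apply: leqW; near: J; exact: nbhs_infty_ge.
rewrite (horner_coef_wide _ JP) sumE.
apply: (@le_trans _ _ (M * q ^+ J)).
  rewrite normcM normcX normcV /q invfM exprMn [_ * r^-1 ^+ J]mulrC mulrA.
  apply: ler_wpM2r; first by rewrite exprn_ge0// invr_ge0 normc_ge0.
  by rewrite exprVn ler_pdivlMr ?exprn_gt0//; exact: gM.
have h : `|0 - M * q ^+ J| < e by near: J; move/cvgrPdist_lt : q1; apply.
by move: h; rewrite sub0r normrN => /ltW; apply: le_trans; exact: ler_norm.
Unshelve. all: by end_near. Qed.

End taylor.

(** * Poles accumulating at the circle *)

Section necessity.
Variable R : realType.
Implicit Types (x z c : R[i]) (r : R) (f h : hol R).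

(** Any extension would do, since only values on the unit circle matter; this one
    is determined by [f] without a choice. *)
Definition hol_ext f x : R[i] :=
  if insub x is Some z then f (z : {z : R[i] | normc z <= 1}) else 0.

Lemma hol_extE f g x : extends g f -> normc x <= 1 -> hol_ext f x = g x.
Proof. by move=> fg x1; rewrite /hol_ext insubT fg. Qed.

Definition taylor f := tcoef (hol_ext f).

Lemma taylorE f g j : extends g f -> taylor f j = tcoef g j.
Proof. by move=> fg; apply: eq_tcoef => x x1; rewrite (hol_extE fg)// x1. Qed.

Lemma hol_analytic_beyond f : exists2 g, analytic_beyond g & extends g f.
Proof.
have [n n0 [g [[ag _] fg]]] := hol_step f; exists g => //.
by exists (radius R n) => //; rewrite /radius ltrDl invr_gt0 ltr0n.
Qed.

Lemma taylor_lin a b f h j :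
  taylor (a *: f + b *: h) j = a * taylor f j + b * taylor h j.
Proof.
have [g ag fg] := hol_analytic_beyond f; have [k ak hk] := hol_analytic_beyond h.
have e : extends (fun x => a * g x + b * k x) (a *: f + b *: h).
  by move=> z; rewrite -fg -hk.
rewrite (taylorE _ e) (taylorE _ fg) (taylorE _ hk).
rewrite (tcoefD _ (analytic_beyondZ a ag) (analytic_beyondZ b ak)).
by rewrite (tcoefZ _ _ ag) (tcoefZ _ _ ak).
Qed.

Lemma radius_gt1 n : (0 < n)%N -> 1 < radius R n.
Proof. by move=> n0; rewrite /radius ltrDl invr_gt0 ltr0n. Qed.

Lemma radius_le n m : (0 < n)%N -> (n <= m)%N -> radius R m <= radius R n.
Proof.
move=> n0 nm; rewrite /radius lerD2l lef_pV2 ?posrE ?ltr0n ?ler_nat//.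
exact: leq_trans nm.
Qed.

Lemma radiusS_lt n : (0 < n)%N -> radius R n.+1 < radius R n.
Proof.
by move=> n0; rewrite /radius ltrD2l ltf_pV2 ?posrE ?ltr0n// ltr_nat.
Qed.

(** On the step of radius [radius R n] the Cauchy estimate at radius [radius R n.+1]
    controls the conditions with [n < m] by a single constant, and only the
    conditions with [m <= n] are left, finitely many. *)
Lemma hol_nbhs0_taylor (jj : nat -> nat) :
  hol_nbhs0 [set f : hol R | forall m, (0 < m)%N ->
    normc (taylor f (jj m)) * radius R m ^+ jj m <= 1].
Proof.
have r0 m : (0 < m)%N -> 0 < radius R m.
  by move=> /radius_gt1; exact: lt_trans.
split.
- exists 0 => m m0 /=; have := taylor_lin 0 0 0 0 (jj m).
  rewrite !scale0r addr0 !mul0r addr0 => ->.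
  by rewrite normc0 mul0r.
- move=> x y a b xV yV ab m m0; rewrite taylor_lin.
  have rm : 0 <= radius R m ^+ jj m by rewrite exprn_ge0// ltW// r0.
  apply: (le_trans (ler_wpM2r rm (normcD _ _))).
  apply: le_trans ab; rewrite mulrDl !normcM -!mulrA; apply: lerD.
    by rewrite -[leRHS]mulr1 ler_wpM2l ?normc_ge0//; exact: xV.
  by rewrite -[leRHS]mulr1 ler_wpM2l ?normc_ge0//; exact: yV.
move=> n n0.
(* [A] dominates the finitely many weights that exceed the Cauchy estimate. *)
pose A : R := \sum_(m < n) radius R m.+1 ^+ jj m.+1.
have A0 : 0 <= A by apply: sumr_ge0 => m _; rewrite exprn_ge0// ltW// r0.
exists (1 + A)^-1; first by rewrite invr_gt0; lra.
move=> g f [ag _] ge fg m m0.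
have r1 := radius_gt1 n0; have rS := radiusS_lt n0; have rS0 := r0 _ (ltn0Sn n).
rewrite (taylorE _ fg).
have gA x : normc x = radius R n.+1 -> normc (g x) <= (1 + A)^-1.
  by move=> xr; apply: ltW; apply: (sup_norm_lt ge); rewrite /disk /= xr.
have := tcoef_cauchy (jj m) r1 rS0 rS ag gA.
set t := normc _ => tA.
have t0 : 0 <= t by exact: normc_ge0.
have A1 : 0 < 1 + A by lra.
have [nm|mn] := ltnP n m.
  apply: (@le_trans _ _ (t * radius R n.+1 ^+ jj m)).
    by rewrite ler_wpM2l// lerXn2r ?nnegrE; [by []|exact: ltW (r0 _ _)|exact: ltW|exact: radius_le].
  by rewrite (le_trans tA)// invf_le1//; lra.
have t1 : t <= (1 + A)^-1.
  apply: le_trans tA; rewrite ler_peMr//; apply: exprn_ege1; apply: ltW; exact: radius_gt1.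
have mA : radius R m ^+ jj m <= 1 + A.
  rewrite /A -(prednK m0) in mn *.
  rewrite (bigD1 (Ordinal mn))//= addrCA lerDl addr_ge0// sumr_ge0// => k _.
  by rewrite exprn_ge0// ltW// r0.
rewrite -(mulVf (lt0r_neq0 A1)); apply: ler_pM => //.
by rewrite exprn_ge0// ltW// r0.
Qed.

Variable lam : nat -> R[i].
Hypothesis hlam : forall n, (1 <= n)%N -> normc (lam n) < 1.

Definition blaschke_num n : {poly R[i]} := \prod_(i < n) ((lam i.+1)%:P - 'X).
Definition blaschke_den n : {poly R[i]} := \prod_(i < n) (1 - (lam i.+1)^* *: 'X).

Lemma blaschke_denS n : blaschke_den n.+1 = blaschke_den n * (1 - (lam n.+1)^* *: 'X).
Proof. by rewrite /blaschke_den big_ord_recr. Qed.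

Lemma blaschke_numS n : blaschke_num n.+1 = blaschke_num n * ((lam n.+1)%:P - 'X).
Proof. by rewrite /blaschke_num big_ord_recr. Qed.

Lemma blaschke_den_neq0_cdisk k x : (1 <= k)%N -> normc x <= 1 -> 1 - (lam k)^* * x != 0.
Proof.
move=> k1 x1; apply: one_sub_neq0; rewrite normc_conj.
apply: le_lt_trans (hlam k1); rewrite -[leRHS]mulr1.
by rewrite ler_wpM2l ?normc_ge0.
Qed.

Lemma blaschke_den_mul n x : normc x <= 1 ->
  (blaschke_den n).[x] * blaschke lam n x = (blaschke_num n).[x].
Proof.
move=> x1; elim: n => [|n IH].
  by rewrite /blaschke_den /blaschke_num !big_ord0 blaschke0 mulr1.
have d0 := blaschke_den_neq0_cdisk (ltn0Sn n) x1.
rewrite blaschke_denS blaschke_numS blaschkeS !hornerE -IH /bfactor.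
rewrite /=; by field.
Qed.

Lemma blaschke_sum_rational (a : nat -> R[i]) n : exists P : {poly R[i]},
  forall x, normc x <= 1 -> (blaschke_den n).[x] * (\sum_(k < n) a k * blaschke lam k x) = P.[x].
Proof.
elim: n => [|n [P PE]].
  by exists 0 => x _; rewrite big_ord0 mulr0 horner0.
exists ((1 - (lam n.+1)^* *: 'X) * (P + a n *: blaschke_num n)) => x x1.
rewrite blaschke_denS big_ord_recr /= !hornerE -PE// -blaschke_den_mul//.
by ring.
Qed.

Lemma blaschke_den_root n x : root (blaschke_den n) x -> exists2 k, (1 <= k)%N & (lam k)^* * x = 1.
Proof.
rewrite /blaschke_den /root horner_prod => /eqP/eqP/prodf_eq0[k _].
rewrite !hornerE subr_eq0 => /eqP e; by exists k.+1.
Qed.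

Lemma blaschke_num_neq0 n k : (1 <= k)%N -> lam k != 0 -> (blaschke_num n).[((lam k)^*)^-1] != 0.
Proof.
move=> k1 lk0; rewrite /blaschke_num horner_prod; apply/prodf_neq0 => i _.
have nlk : 0 < normc (lam k) by rewrite normc_gt0.
rewrite !hornerE subr_eq0; apply/eqP => e.
have := hlam (ltn0Sn i); rewrite e normcV normc_conj invf_lt1//.
by move=> h; have := hlam k1; rewrite ltNge (ltW h).
Qed.

Lemma blaschke_analytic_beyond n : analytic_beyond (blaschke lam n).
Proof.
have [U [oU DU aU]] := blaschke_analytic n hlam.
have [d d0 dU] := cdisk_nbhs oU DU.
exists (1 + d); first by rewrite ltrDl.
by move=> z zr; apply: aU; apply: dU; exact: ltW.
Qed.

(** Multiplying by the other denominators keeps the weighted coefficients bounded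
    and isolates the pole at the inverse of [(lam k)^*], where the numerator does not
    vanish. *)
Lemma blaschke_tcoef_unbounded n k r : (1 <= k)%N -> (k <= n)%N -> 0 < r ->
  1 < normc (lam k) * r -> ~ tcoef_bounded r (blaschke lam n).
Proof.
move=> k1 kn r0 lr bB.
have lk0 : lam k != 0.
  by apply/eqP => e; move: lr; rewrite e normc0 mul0r ltNge ler01.
have kn' : (k.-1 < n)%N by rewrite prednK.
pose D1 : {poly R[i]} := \prod_(i < n | i != Ordinal kn') (1 - (lam i.+1)^* *: 'X).
have DE : blaschke_den n = (1 - (lam k)^* *: 'X) * D1.
  by rewrite /blaschke_den (bigD1 (Ordinal kn'))//= prednK.
have := tcoef_bounded_pole (tcoef_boundedM D1 (ltW r0) bB) (_ : 1 < normc (lam k)^* * r) r0.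
rewrite normc_conj => /(_ (blaschke_num n) lr) H.
suff /H/eqP : forall x, normc x = 1 ->
    (1 - (lam k)^* * x) * (D1.[x] * blaschke lam n x) = (blaschke_num n).[x].
  by apply/negP; exact: blaschke_num_neq0.
move=> x x1; rewrite -blaschke_den_mul ?x1// DE !hornerE.
by rewrite /=; ring.
Qed.

(** The countable sequence cannot exhaust an interval of positive measure. *)
Lemma exists_real_avoiding : exists2 nu : R, 0 < nu < 1 &
  forall k, (1 <= k)%N -> (lam k)^* != nu%:C%C.
Proof.
apply: contrapT => H.
have sub : `]0, 1[%classic `<=` range (fun k => complex.Re (lam k)).
  move=> nu /=; rewrite in_itv /= => nu01; apply: contrapT => nk; apply: H.
  exists nu => // k k1; apply/eqP => e; apply: nk; exists k => //.
  by move: e; case: (lam k) => u v [].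
have : countable (`]0, 1[%classic : set R).
  apply: (sub_countable (subset_card_le sub)).
  by apply: (sub_countable (card_image_le _ _)); exact: countableP.
move=> /countable_lebesgue_measure0; rewrite lebesgue_measure_itv /= lte_fin ltr01.
by rewrite oppr0 adde0 => /eqP; rewrite eqe oner_eq0.
Qed.

Lemma cauchy_kernel_hol (nu : R) : 0 < nu < 1 ->
  exists y : hol R, extends (fun x => (1 - nu%:C%C * x)^-1) y.
Proof.
move=> /andP[nu0 nu1].
have yP : (fun z : closed_disk R => (1 - nu%:C%C * val z)^-1) \in @hol_pred R.
  apply/asboolP; exists (disk nu^-1), (fun x => (1 - nu%:C%C * x)^-1); split => //.
  - rewrite openE => z zr; apply/nearC; exists (nu^-1 - normc z); first by rewrite subr_gt0.
    move=> w wz; rewrite /disk /=; have := normcD (w - z) z; rewrite subrK.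
    by lra.
  - move=> z z1; rewrite /disk /=; apply: le_lt_trans z1 _.
    by rewrite invf_gt1.
  - apply: analytic_disk_inv; rewrite normc_real gtr0_norm// divff// gt_eqF//.
by exists (Hol yP).
Qed.

(** A finite combination of Blaschke products has poles at inverses of the
    [(lam k)^*] only, whereas [y] has one at [nu^-1]. *)
Lemma cauchy_kernel_infinite (nu : R) (y : hol R) (a : nat -> R[i]) :
  0 < nu < 1 -> (forall k, (1 <= k)%N -> (lam k)^* != nu%:C%C) ->
  extends (fun x => (1 - nu%:C%C * x)^-1) y ->
  series (fun n => a n *: blaschke_hol hlam n) @ \oo --> y ->
  forall n, exists2 m, (n <= m)%N & a m != 0.
Proof.
move=> /andP[nu0 nu1] nulam yE ay n; apply: contrapT => H.
have a0 m : (n <= m)%N -> a m = 0.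
  by move=> nm; apply/eqP; apply: contrapT => /negP am; apply: H; exists m.
have nuC : nu%:C%C != 0 :> R[i] by rewrite (inj_eq (@complexI R)) gt_eqF.
have yx x : normc x = 1 -> \sum_(k < n) a k * blaschke lam k x = (1 - nu%:C%C * x)^-1.
  move=> x1; have xle : normc x <= 1 by rewrite x1.
  pose z : closed_disk R := exist _ x xle.
  apply/eqP; rewrite -subr_eq0 -normc_eq0 eq_le normc_ge0 andbT.
  apply/ler_addgt0Pr => e e0; rewrite add0r.
  have [N0 _ hN] := hol_cvg_unif e0 ay.
  have := hN (maxn N0 n) (leq_maxl _ _) z; rewrite yE hol_seriesE.
  congr (normc (_ - _) <= _).
  rewrite (big_ord_widen _ (fun k => a k * blaschke lam k x) (leq_maxr N0 n)).
  rewrite [RHS]big_mkcond /=; apply: eq_bigr => k _.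
  by case: ltnP => // /a0 ->; rewrite mul0r.
have [P PE] := blaschke_sum_rational a n.
have DE : blaschke_den n = (1 - nu%:C%C *: 'X) * P.
  apply: poly_circle_inj => x x1; rewrite !hornerE -PE ?x1// yx// mulrC.
  by rewrite divfK// one_sub_neq0// x1 mulr1 normc_real gtr0_norm.
have /blaschke_den_root[k k1 lk] : root (blaschke_den n) nu%:C%C^-1.
  by rewrite DE rootM /root !hornerE mulfV// subrr eqxx.
have := nulam k k1; apply/negP; rewrite negbK; apply/eqP.
by rewrite -[LHS]mulr1 -(mulVf nuC) mulrA lk mul1r.
Qed.

Lemma schauder_term_cvg (a : nat -> R[i]) (y : hol R) V : hol_nbhs0 V ->
  series (fun n => a n *: blaschke_hol hlam n) @ \oo --> y ->
  \forall n \near \oo, V (a n *: blaschke_hol hlam n).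
Proof.
move=> bV /hol_cvgP /(_ _ (hol_nbhs0Z 2 bV)) [N0 _ h].
exists N0 => // n N0n; have [_ aV _] := bV.
have := aV _ _ 2^-1 (- 2^-1) (h n.+1 (leq_trans N0n (leqnSn n))) (h n N0n).
rewrite !scalerA mulNr mulVf ?pnatr_eq0// scaleN1r scale1r opprB addrA subrK.
rewrite /series /= big_nat_recr//= addrAC subrr add0r; apply.
rewrite normcN normcV normc_nat; lra.
Qed.

(** The conclusion says that the [lam k] stay inside a smaller disk; otherwise one
    bad coefficient for each radius [radius R m] produces a neighbourhood of zero
    that infinitely many terms of the expansion of [y] avoid. *)
Lemma schauder_basis_bound : schauder_basis (blaschke_hol hlam) ->
  exists2 m : nat, (0 < m)%N & forall k, (1 <= k)%N -> normc (lam k) * radius R m <= 1.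
Proof.
move=> basis; apply: contrapT => H.
have [nu nu01 nulam] := exists_real_avoiding.
have [y yE] := cauchy_kernel_hol nu01.
have [a [ay _]] := basis y.
have a_inf := cauchy_kernel_infinite nu01 nulam yE ay.
have bad (m : nat) : exists p : nat * nat, (0 < m)%N -> (m <= p.1)%N /\
    1 < normc (taylor (a p.1 *: blaschke_hol hlam p.1) p.2) * radius R m ^+ p.2.
  have [m0|m0] := posnP m; first by exists (0, 0)%N; rewrite m0.
  have r0 : 0 < radius R m by exact: lt_trans (radius_gt1 m0).
  have [k [k1 kr]] : exists k, (1 <= k)%N /\ 1 < normc (lam k) * radius R m.
    apply: contrapT => Hk; apply: H; exists m => // k k1; rewrite leNgt.
    by apply/negP => kr; apply: Hk; exists k.
  have [n nk an] := a_inf (maxn m k).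
  have [nm kn] : (m <= n)%N /\ (k <= n)%N.
    by apply/andP; rewrite -geq_max.
  have na0 : 0 < normc (a n) by rewrite normc_gt0.
  apply: contrapT => Hp; apply: (blaschke_tcoef_unbounded k1 kn r0 kr).
  split; first exact: blaschke_analytic_beyond.
  exists (normc (a n))^-1 => j; rewrite leNgt; apply/negP => hj; apply: Hp.
  exists (n, j) => _ /=; split => //.
  have e : extends (fun x => a n * blaschke lam n x) (a n *: blaschke_hol hlam n).
    by [].
  rewrite (taylorE _ e) (tcoefZ _ _ (blaschke_analytic_beyond n)) normcM.
  by rewrite -mulrA mulrC -ltr_pdivrMr// mul1r.
have [p pP] := choice bad.
have [N0 _ small] := schauder_term_cvg (hol_nbhs0_taylor (fun m => (p m).2)) ay.
have [pN] := pP N0.+1 (ltn0Sn _).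
have := small (p N0.+1).1; rewrite /= => small1 pN1.
have := small1 (ltnW pN) N0.+1 (ltn0Sn _).
by rewrite leNgt pN1.
Qed.

End necessity.

Theorem theorem5p3 (R : realType) (lam : nat -> R[i])
    (hlam : forall n, (1 <= n)%N -> normc (lam n) < 1) :
  schauder_basis (blaschke_hol hlam) <->
  sup [set normc (lam n) | n in [set n : nat | (1 <= n)%N]] < 1.
Proof.
set A := [set _ | _ in _].
have A0 : A !=set0 by exists (normc (lam 1%N)); exists 1%N.
have ubA (b : R) : (forall k, (1 <= k)%N -> normc (lam k) <= b) -> ubound A b.
  by move=> lb _ [k k1 <-]; exact: lb.
split=> [/schauder_basis_bound[m m0 lr]|supA].
  have r1 := @radius_gt1 R m m0.
  have r0 : 0 < radius R m by exact: lt_trans r1.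
  apply: (@le_lt_trans _ _ (radius R m)^-1); last by rewrite invf_lt1.
  apply: ge_sup => //; apply: ubA => k k1.
  by rewrite -[leRHS]mul1r ler_pdivlMr// lr.
have lr k : (1 <= k)%N -> normc (lam k) <= sup A.
  move=> k1; apply: ub_le_sup; last by exists k.
  by exists 1; apply: ubA => j j1; exact/ltW/hlam.
move=> f; have [a af] := blaschke_series_cvg hlam supA lr f.
by exists a; split=> // b bf; exact: blaschke_coef_unique supA lr _ _ _ af bf.
Qed.
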